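(* Let $F:\mathcal{K}\to\mathcal{L}$ be a morphism of small tensor triangulated categories, let $\phi:\operatorname{Spc}(\mathcal{L})\to\operatorname{Spc}(\mathcal{K})$ be the induced map $\mathcal{P}\mapsto F^{-1}(\mathcal{P})$, and let $\mathcal{Z}\subset\operatorname{Spc}(\mathcal{K})$ be a closed subset. Then there is a commutative diagram $$\begin{array}{ccccc}\operatorname{Spc}(\mathcal{L})&\supset&\phi^{-1}(\mathcal{Z})&\xrightarrow{\ \rho_{\mathcal{L},\phi^{-1}(\mathcal{Z})}\ }&\operatorname{Spec}(R_{\mathcal{L},\phi^{-1}(\mathcal{Z})})\\ {\scriptstyle\phi}\downarrow&&\downarrow&&\downarrow\\ \operatorname{Spc}(\mathcal{K})&\supset&\mathcal{Z}&\xrightarrow{\ \rho_{\mathcal{K},\mathcal{Z}}\ }&\operatorname{Spec}(R_{\mathcal{K},\mathcal{Z}})\end{array}$$ in the category of spectral spaces, where the right vertical map is induced by the ring homomorphism $R_{\mathcal{K},\mathcal{Z}}\to R_{\mathcal{L},\phi^{-1}(\mathcal{Z})}$, $[f]\mapsto[F(f)]$, and the left square is cartesian.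
   Context: A tensor triangulated category is a triangulated category $(\mathcal{K},\Sigma)$ with a symmetric monoidal structure $(\otimes,\mathbb{1})$ such that $a\otimes -$ and $-\otimes a$ are exact for every $a$ (with suspension isomorphisms $\Sigma a\otimes b\simeq\Sigma(a\otimes b)\simeq a\otimes\Sigma b$ compatible with the symmetric monoidal structure, and the two isomorphisms $\Sigma a\otimes\Sigma b\simeq\Sigma^2(a\otimes b)$ differing by $-1$). A morphism of tensor triangulated categories is an exact functor that is also a strong (symmetric) $\otimes$-functor, the structure isomorphisms being compatible with each other and with the suspension isomorphisms. $\operatorname{Spc}(\mathcal{K})$ is the set of prime $\otimes$-ideals (proper thick $\otimes$-ideals $\mathcal{P}$ with $a\otimes b\in\mathcal{P}\Rightarrow a\in\mathcal{P}$ or $b\in\mathcal{P}$), with topology having the sets $\operatorname{supp}(a):=\{\mathcal{P}\mid a\notin\mathcal{P}\}$ as a basis of closed sets; it and its closed subspaces are spectral spaces. Morphisms of spectral spaces are spectral maps: continuous maps for which preimages of quasi-compact open sets are quasi-compact. For an object $X$, $E_X:=\{f\in[X,X]\mid f\otimes X=X\otimes f\}$, a subring of $[X,X]$. For a closed subset $\mathcal{Z}\subset\operatorname{Spc}(\mathcal{K})$ put $\Phi:=\{a\in\mathcal{K}\mid\operatorname{supp}(a)\supset\mathcal{Z}\}$, which is closed under $\otimes$. $R_{\mathcal{Z}}=R_{\mathcal{K},\mathcal{Z}}$ is the set of pairs $(X,f)$ with $X\in\Phi$, $f\in E_X$, modulo the smallest equivalence relation with $(X,f)\sim(a\otimes X,a\otimes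 f)$ and $(X,f)\sim(X\otimes a,f\otimes a)$ for all $a\in\Phi$; the class of $(X,f)$ is $[f]$. It is a commutative ring with $[f_X]+[g_Y]=[f_X\otimes Y+X\otimes g_Y]$ and $[f_X][g_Y]=[(f_X\otimes Y)\circ(X\otimes g_Y)]$. The map $\rho_{\mathcal{K},\mathcal{Z}}:\mathcal{Z}\to\operatorname{Spec}(R_{\mathcal{K},\mathcal{Z}})$ is the spectral map $\mathcal{P}\mapsto\{[f]\mid\operatorname{cone}(f)\notin\mathcal{P}\}$ (note $\bigcap_{X\in\Phi}\operatorname{supp}(X)=\mathcal{Z}$). *)

(* Defs.v *)
From HB Require Import structures.
From mathcomp Require Import all_boot all_order all_algebra.
From mathcomp Require Import all_classical topology.
From Stdlib Require Import Relation_Operators.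

Set Implicit Arguments.
Unset Strict Implicit.
Unset Printing Implicit Defensive.

Import GRing.Theory.
Local Open Scope classical_set_scope.
Local Open Scope quotient_scope.
Local Open Scope ring_scope.

Reserved Notation "g ∘ f" (at level 40, left associativity).
Reserved Notation "a ⊗ b" (at level 37, left associativity).
Reserved Notation "f ⊗₁ g" (at level 37, left associativity).
Reserved Notation "'Σ' a" (at level 10, a at level 8, format "'Σ'  a").
Reserved Notation "'Σ₁' f" (at level 10, f at level 8, format "'Σ₁'  f").

(* Objects and morphisms live in Type: all categories are small. *)

Record cat_data := CatData {
  ob :> Type;
  hom : ob -> ob -> zmodType;
  idm : forall a, hom a a;
  comp : forall a b c, hom b c -> hom a b -> hom a c
}.
Arguments idm {_} a.

Declare Scope cat_scope.
Delimit Scope cat_scope with cat.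
Open Scope cat_scope.
Notation "g ∘ f" := (comp g f) : cat_scope.

Record preadditive_axioms (C : cat_data) : Prop := PreadditiveAxioms {
  compA : forall (a b c d : C) (h : hom c d) (g : hom b c) (f : hom a b),
    h ∘ (g ∘ f) = (h ∘ g) ∘ f;
  comp1m : forall (a b : C) (f : hom a b), idm b ∘ f = f;
  compm1 : forall (a b : C) (f : hom a b), f ∘ idm a = f;
  compDl : forall (a b c : C) (g g' : hom b c) (f : hom a b),
    (g + g') ∘ f = g ∘ f + g' ∘ f;
  compDr : forall (a b c : C) (g : hom b c) (f f' : hom a b),
    g ∘ (f + f') = g ∘ f + g ∘ f'
}.

Definition is_iso (C : cat_data) (a b : C) (f : hom a b) : Prop :=
  exists g : hom b a, g ∘ f = idm a /\ f ∘ g = idm b.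

Definition isomorphic (C : cat_data) (a b : C) : Prop :=
  exists f : hom a b, is_iso f.

Definition is_zero_object (C : cat_data) (z : C) : Prop :=
  forall a : C, (forall f : hom z a, f = 0) /\ (forall f : hom a z, f = 0).

Record is_biproduct (C : cat_data) (a b c : C) (i1 : hom a c) (i2 : hom b c)
    (p1 : hom c a) (p2 : hom c b) : Prop := IsBiproduct {
  biprod11 : p1 ∘ i1 = idm a;
  biprod22 : p2 ∘ i2 = idm b;
  biprod12 : p1 ∘ i2 = 0;
  biprod21 : p2 ∘ i1 = 0;
  biprod_sum : i1 ∘ p1 + i2 ∘ p2 = idm c
}.

Definition is_direct_sum (C : cat_data) (a b c : C) : Prop :=
  exists (i1 : hom a c) (i2 : hom b c) (p1 : hom c a) (p2 : hom c b),
    is_biproduct i1 i2 p1 p2.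

Record additive_axioms (C : cat_data) : Prop := AdditiveAxioms {
  additive_preadditive : preadditive_axioms C;
  has_zero_object : exists z : C, is_zero_object z;
  has_direct_sums : forall a b : C, exists c : C, is_direct_sum a b c
}.

Record tri_data := TriData {
  tri_cat :> cat_data;
  susp : tri_cat -> tri_cat;
  suspm : forall a b, hom a b -> hom (susp a) (susp b);
  dist : forall x y z, hom x y -> hom y z -> hom z (susp x) -> Prop
}.

Notation "'Σ' a" := (susp a) : cat_scope.
Notation "'Σ₁' f" := (suspm f) : cat_scope.

(* Σ is only required to be an additive auto-equivalence, not an automorphism. *)
Record suspension_axioms (T : tri_data) : Prop := SuspensionAxioms {
  suspm_id : forall a : T, Σ₁ (idm a) = idm (Σ a);
  suspm_comp : forall (a b c : T) (g : hom b c) (f : hom a b),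
    Σ₁ (g ∘ f) = Σ₁ g ∘ Σ₁ f;
  suspm_add : forall (a b : T) (f g : hom a b), Σ₁ (f + g) = Σ₁ f + Σ₁ g;
  suspm_faithful : forall (a b : T) (f g : hom a b), Σ₁ f = Σ₁ g -> f = g;
  suspm_full : forall (a b : T) (g : hom (Σ a) (Σ b)),
    exists f : hom a b, Σ₁ f = g;
  susp_esurj : forall b : T, exists a : T, isomorphic (Σ a) b
}.

(* TR4 is the octahedral axiom, for arbitrary choices of the three cones. *)
Record triangle_axioms (T : tri_data) : Prop := TriangleAxioms {
  TR1_iso : forall (x y z x' y' z' : T)
    (u : hom x y) (v : hom y z) (w : hom z (Σ x))
    (u' : hom x' y') (v' : hom y' z') (w' : hom z' (Σ x'))
    (f : hom x x') (g : hom y y') (h : hom z z'),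
    is_iso f -> is_iso g -> is_iso h ->
    g ∘ u = u' ∘ f -> h ∘ v = v' ∘ g -> Σ₁ f ∘ w = w' ∘ h ->
    dist u v w -> dist u' v' w';
  TR1_id : forall x z : T, is_zero_object z ->
    dist (idm x) (0 : hom x z) (0 : hom z (Σ x));
  TR1_cone : forall (x y : T) (u : hom x y),
    exists (z : T) (v : hom y z) (w : hom z (Σ x)), dist u v w;
  TR2 : forall (x y z : T) (u : hom x y) (v : hom y z) (w : hom z (Σ x)),
    dist u v w <-> dist v w (- Σ₁ u);
  TR3 : forall (x y z x' y' z' : T)
    (u : hom x y) (v : hom y z) (w : hom z (Σ x))
    (u' : hom x' y') (v' : hom y' z') (w' : hom z' (Σ x'))
    (f : hom x x') (g : hom y y'),
    dist u v w -> dist u' v' w' -> g ∘ u = u' ∘ f ->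
    exists h : hom z z', h ∘ v = v' ∘ g /\ Σ₁ f ∘ w = w' ∘ h;
  TR4 : forall (x y z c d e : T) (u : hom x y) (v : hom y z)
    (i : hom y c) (i' : hom c (Σ x))
    (j : hom z d) (j' : hom d (Σ y))
    (k : hom z e) (k' : hom e (Σ x)),
    dist u i i' -> dist v j j' -> dist (v ∘ u) k k' ->
    exists (f : hom c e) (g : hom e d),
      [/\ dist f g (Σ₁ i ∘ j'),
          f ∘ i = k ∘ v, k' ∘ f = i', g ∘ k = j & j' ∘ g = Σ₁ u ∘ k']
}.

Record triangulated_axioms (T : tri_data) : Prop := TriangulatedAxioms {
  triangulated_additive : additive_axioms T;
  triangulated_suspension : suspension_axioms T;
  triangulated_triangles : triangle_axioms T
}.

Definition is_cone (T : tri_data) (x y : T) (u : hom x y) (c : T) : Prop :=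
  exists (v : hom y c) (w : hom c (Σ x)), dist u v w.

(* The object map F0 and morphism map F1 form an exact functor with
   suspension isomorphism s : F0 Σ -> Σ F0. *)
Record is_exact_functor (S T : tri_data) (F0 : S -> T)
    (F1 : forall a b : S, hom a b -> hom (F0 a) (F0 b))
    (s : forall a : S, hom (F0 (Σ a)) (Σ (F0 a))) : Prop := IsExactFunctor {
  exact_id : forall a : S, F1 a a (idm a) = idm (F0 a);
  exact_comp : forall (a b c : S) (g : hom b c) (f : hom a b),
    F1 a c (g ∘ f) = F1 b c g ∘ F1 a b f;
  exact_add : forall (a b : S) (f g : hom a b),
    F1 a b (f + g) = F1 a b f + F1 a b g;
  exact_susp_iso : forall a : S, is_iso (s a);
  exact_susp_nat : forall (a b : S) (f : hom a b),
    s b ∘ F1 _ _ (Σ₁ f) = Σ₁ (F1 a b f) ∘ s a;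
  exact_dist : forall (x y z : S)
    (u : hom x y) (v : hom y z) (w : hom z (Σ x)),
    dist u v w -> dist (F1 x y u) (F1 y z v) (s x ∘ F1 z (Σ x) w)
}.

Record tt_data := TTData {
  tt_tri :> tri_data;
  tens : tt_tri -> tt_tri -> tt_tri;
  tensm : forall a a' b b',
    hom a a' -> hom b b' -> hom (tens a b) (tens a' b');
  unit_ob : tt_tri;
  assoc : forall a b c, hom (tens (tens a b) c) (tens a (tens b c));
  lunit : forall a, hom (tens unit_ob a) a;
  runit : forall a, hom (tens a unit_ob) a;
  braid : forall a b, hom (tens a b) (tens b a);
  lsusp : forall a b, hom (tens (susp a) b) (susp (tens a b));
  rsusp : forall a b, hom (tens a (susp b)) (susp (tens a b))
}.
Arguments unit_ob {_}.

Notation "a ⊗ b" := (tens a b) : cat_scope.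
Notation "f ⊗₁ g" := (tensm f g) : cat_scope.
Notation "'𝟙'" := unit_ob : cat_scope.

Record monoidal_axioms (K : tt_data) : Prop := MonoidalAxioms {
  tensm_id : forall a b : K, idm a ⊗₁ idm b = idm (a ⊗ b);
  tensm_comp : forall (a a' a'' b b' b'' : K) (f' : hom a' a'')
    (f : hom a a') (g' : hom b' b'') (g : hom b b'),
    (f' ∘ f) ⊗₁ (g' ∘ g) = (f' ⊗₁ g') ∘ (f ⊗₁ g);
  assoc_iso : forall a b c : K, is_iso (assoc a b c);
  assoc_nat : forall (a a' b b' c c' : K)
    (f : hom a a') (g : hom b b') (h : hom c c'),
    assoc a' b' c' ∘ ((f ⊗₁ g) ⊗₁ h) = (f ⊗₁ (g ⊗₁ h)) ∘ assoc a b c;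
  lunit_iso : forall a : K, is_iso (lunit a);
  lunit_nat : forall (a a' : K) (f : hom a a'),
    lunit a' ∘ (idm 𝟙 ⊗₁ f) = f ∘ lunit a;
  runit_iso : forall a : K, is_iso (runit a);
  runit_nat : forall (a a' : K) (f : hom a a'),
    runit a' ∘ (f ⊗₁ idm 𝟙) = f ∘ runit a;
  pentagon : forall a b c d : K,
    assoc a b (c ⊗ d) ∘ assoc (a ⊗ b) c d =
    (idm a ⊗₁ assoc b c d) ∘ assoc a (b ⊗ c) d ∘ (assoc a b c ⊗₁ idm d);
  unit_triangle : forall a b : K,
    (idm a ⊗₁ lunit b) ∘ assoc a 𝟙 b = runit a ⊗₁ idm b;
  braid_nat : forall (a a' b b' : K) (f : hom a a') (g : hom b b'),
    braid a' b' ∘ (f ⊗₁ g) = (g ⊗₁ f) ∘ braid a b;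
  braid_sym : forall a b : K, braid b a ∘ braid a b = idm (a ⊗ b);
  hexagon : forall a b c : K,
    assoc b c a ∘ braid a (b ⊗ c) ∘ assoc a b c =
    (idm b ⊗₁ braid a c) ∘ assoc b a c ∘ (braid a b ⊗₁ idm c)
}.

(* The suspension isomorphisms lsusp : Σa ⊗ b -> Σ(a ⊗ b) and
   rsusp : a ⊗ Σb -> Σ(a ⊗ b) commute with the unitors, the associator (with Σ
   in each of the three positions) and the braiding. *)
Record tt_compat_axioms (K : tt_data) : Prop := TTCompatAxioms {
  tens_exact_l : forall a : K,
    @is_exact_functor K K (fun b => a ⊗ b)
      (fun b b' f => idm a ⊗₁ f) (fun b => rsusp a b);
  tens_exact_r : forall a : K,
    @is_exact_functor K K (fun b => b ⊗ a)
      (fun b b' f => f ⊗₁ idm a) (fun b => lsusp b a);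
  lsusp_nat : forall (a a' b b' : K) (f : hom a a') (g : hom b b'),
    lsusp a' b' ∘ (Σ₁ f ⊗₁ g) = Σ₁ (f ⊗₁ g) ∘ lsusp a b;
  rsusp_nat : forall (a a' b b' : K) (f : hom a a') (g : hom b b'),
    rsusp a' b' ∘ (f ⊗₁ Σ₁ g) = Σ₁ (f ⊗₁ g) ∘ rsusp a b;
  lsusp_runit : forall a : K, Σ₁ (runit a) ∘ lsusp a 𝟙 = runit (Σ a);
  rsusp_lunit : forall a : K, Σ₁ (lunit a) ∘ rsusp 𝟙 a = lunit (Σ a);
  susp_assoc1 : forall a b c : K,
    Σ₁ (assoc a b c) ∘ lsusp (a ⊗ b) c ∘ (lsusp a b ⊗₁ idm c) =
    lsusp a (b ⊗ c) ∘ assoc (Σ a) b c;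
  susp_assoc2 : forall a b c : K,
    Σ₁ (assoc a b c) ∘ lsusp (a ⊗ b) c ∘ (rsusp a b ⊗₁ idm c) =
    rsusp a (b ⊗ c) ∘ (idm a ⊗₁ lsusp b c) ∘ assoc a (Σ b) c;
  susp_assoc3 : forall a b c : K,
    Σ₁ (assoc a b c) ∘ rsusp (a ⊗ b) c =
    rsusp a (b ⊗ c) ∘ (idm a ⊗₁ rsusp b c) ∘ assoc a b (Σ c);
  susp_braid : forall a b : K,
    Σ₁ (braid a b) ∘ lsusp a b = rsusp b a ∘ braid (Σ a) b;
  susp_anticomm : forall a b : K,
    Σ₁ (rsusp a b) ∘ lsusp a (Σ b) = - (Σ₁ (lsusp a b) ∘ rsusp (Σ a) b)
}.

Record tt_axioms (K : tt_data) : Prop := TTAxioms {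
  tt_triangulated : triangulated_axioms K;
  tt_monoidal : monoidal_axioms K;
  tt_compat : tt_compat_axioms K
}.

Record tt_category := TTCategory {
  tt_struct :> tt_data;
  ttP : tt_axioms tt_struct
}.

Record tt_functor_data (K L : tt_data) := TTFunctorData {
  fob :> K -> L;
  fmap : forall a b : K, hom a b -> hom (fob a) (fob b);
  fsusp : forall a : K, hom (fob (Σ a)) (Σ (fob a));
  fmul : forall a b : K, hom (fob a ⊗ fob b) (fob (a ⊗ b));
  funit : hom 𝟙 (fob 𝟙)
}.
Arguments fmap {K L} _ {a b} f.

Record tt_functor_axioms (K L : tt_data) (F : tt_functor_data K L) : Prop :=
  TTFunctorAxioms {
  functor_exact : is_exact_functor (@fmap K L F) (fsusp F);
  fmul_iso : forall a b : K, is_iso (fmul F a b);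
  fmul_nat : forall (a a' b b' : K) (f : hom a a') (g : hom b b'),
    fmul F a' b' ∘ (fmap F f ⊗₁ fmap F g) = fmap F (f ⊗₁ g) ∘ fmul F a b;
  funit_iso : is_iso (funit F);
  fmul_assoc : forall a b c : K,
    fmap F (assoc a b c) ∘ fmul F (a ⊗ b) c ∘ (fmul F a b ⊗₁ idm (F c)) =
    fmul F a (b ⊗ c) ∘ (idm (F a) ⊗₁ fmul F b c) ∘ assoc (F a) (F b) (F c);
  fmul_lunit : forall a : K,
    fmap F (lunit a) ∘ fmul F 𝟙 a ∘ (funit F ⊗₁ idm (F a)) = lunit (F a);
  fmul_runit : forall a : K,
    fmap F (runit a) ∘ fmul F a 𝟙 ∘ (idm (F a) ⊗₁ funit F) = runit (F a);
  fmul_braid : forall a b : K,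
    fmap F (braid a b) ∘ fmul F a b = fmul F b a ∘ braid (F a) (F b);
  fmul_lsusp : forall a b : K,
    fsusp F (a ⊗ b) ∘ fmap F (lsusp a b) ∘ fmul F (Σ a) b =
    Σ₁ (fmul F a b) ∘ lsusp (F a) (F b) ∘ (fsusp F a ⊗₁ idm (F b));
  fmul_rsusp : forall a b : K,
    fsusp F (a ⊗ b) ∘ fmap F (rsusp a b) ∘ fmul F a (Σ b) =
    Σ₁ (fmul F a b) ∘ rsusp (F a) (F b) ∘ (idm (F a) ⊗₁ fsusp F b)
}.

Record tt_functor (K L : tt_category) := TTFunctor {
  tt_functor_struct :> tt_functor_data K L;
  ttfP : tt_functor_axioms tt_functor_struct
}.

(* Closure under cones in this position suffices: with closure under Σ and its
   inverse, rotation (TR2) gives two-out-of-three. *)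
Record is_thick (K : tri_data) (J : set K) : Prop := IsThick {
  thick_zero : forall z : K, is_zero_object z -> J z;
  thick_iso : forall a b : K, isomorphic a b -> J a -> J b;
  thick_susp : forall a : K, J a <-> J (Σ a);
  thick_dist : forall (x y z : K)
    (u : hom x y) (v : hom y z) (w : hom z (Σ x)),
    dist u v w -> J x -> J y -> J z;
  thick_summand : forall a b c : K, is_direct_sum a b c -> J c -> J a
}.

Record is_thick_ideal (K : tt_data) (J : set K) : Prop := IsThickIdeal {
  ideal_thick : is_thick J;
  ideal_tens : forall a b : K, J b -> J (a ⊗ b);
  ideal_tens_r : forall a b : K, J a -> J (a ⊗ b)
}.

Record is_prime (K : tt_data) (P : set K) : Prop := IsPrime {
  prime_ideal : is_thick_ideal P;
  prime_proper : exists a : K, ~ P a;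
  prime_tens : forall a b : K, P (a ⊗ b) -> P a \/ P b
}.

Record Spc (K : tt_category) := MkSpc {
  spc_set :> set K;
  spcP : is_prime spc_set
}.

HB.instance Definition _ (K : tt_category) := gen_eqMixin (Spc K).
HB.instance Definition _ (K : tt_category) := gen_choiceMixin (Spc K).

Definition supp (K : tt_category) (a : K) : set (Spc K) :=
  [set P : Spc K | ~ spc_set P a].

(* The complements of the sets supp a form a basis of open sets. *)
Definition spc_open (K : tt_category) : set_system (Spc K) :=
  [set U | forall P, U P -> exists a : K, (~` supp a) P /\ ~` supp a `<=` U].

Section Theory.
Variable K : tt_category.

Let Kadd : additive_axioms K :=
  triangulated_additive (tt_triangulated (ttP K)).
Let Kpre : preadditive_axioms K := additive_preadditive Kadd.
Let Ksusp : suspension_axioms K :=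
  triangulated_suspension (tt_triangulated (ttP K)).
Let Ktri : triangle_axioms K :=
  triangulated_triangles (tt_triangulated (ttP K)).
Let Kmon : monoidal_axioms K := tt_monoidal (ttP K).
Let Kcompat : tt_compat_axioms K := tt_compat (ttP K).

Lemma cA (a b c d : K) (h : hom c d) (g : hom b c) (f : hom a b) :
  h ∘ (g ∘ f) = (h ∘ g) ∘ f.
Proof. exact: compA. Qed.
Lemma c1m (a b : K) (f : hom a b) : idm b ∘ f = f.
Proof. exact: comp1m. Qed.
Lemma cm1 (a b : K) (f : hom a b) : f ∘ idm a = f.
Proof. exact: compm1. Qed.
Lemma cDl (a b c : K) (g g' : hom b c) (f : hom a b) :
  (g + g') ∘ f = g ∘ f + g' ∘ f.
Proof. exact: compDl. Qed.
Lemma cDr (a b c : K) (g : hom b c) (f f' : hom a b) :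
  g ∘ (f + f') = g ∘ f + g ∘ f'.
Proof. exact: compDr. Qed.
Lemma c0m (a b c : K) (f : hom a b) : (0 : hom b c) ∘ f = 0.
Proof. by apply: (addrI (0 ∘ f)); rewrite -cDl !addr0. Qed.
Lemma cm0 (a b c : K) (g : hom b c) : g ∘ (0 : hom a b) = 0.
Proof. by apply: (addrI (g ∘ 0)); rewrite -cDr !addr0. Qed.
Lemma cNl (a b c : K) (g : hom b c) (f : hom a b) : (- g) ∘ f = - (g ∘ f).
Proof. by apply: (addrI (g ∘ f)); rewrite -cDl !addrN c0m. Qed.
Lemma cNr (a b c : K) (g : hom b c) (f : hom a b) : g ∘ (- f) = - (g ∘ f).
Proof. by apply: (addrI (g ∘ f)); rewrite -cDr !addrN cm0. Qed.

Lemma s1 (a : K) : Σ₁ (idm a) = idm (Σ a).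
Proof. exact: suspm_id. Qed.
Lemma sC (a b c : K) (g : hom b c) (f : hom a b) :
  Σ₁ (g ∘ f) = Σ₁ g ∘ Σ₁ f.
Proof. exact: suspm_comp. Qed.
Lemma sD (a b : K) (f g : hom a b) : Σ₁ (f + g) = Σ₁ f + Σ₁ g.
Proof. exact: suspm_add. Qed.
Lemma s0 (a b : K) : Σ₁ (0 : hom a b) = 0.
Proof. by apply: (addrI (Σ₁ 0)); rewrite -sD !addr0. Qed.

Lemma iso_id (a : K) : is_iso (idm a).
Proof. by exists (idm a); rewrite !c1m. Qed.
Lemma iso_comp (a b c : K) (g : hom b c) (f : hom a b) :
  is_iso g -> is_iso f -> is_iso (g ∘ f).
Proof.
move=> [g' [gg' g'g]] [f' [ff' f'f]]; exists (f' ∘ g'); split.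
  by rewrite cA -(cA f') gg' cm1 ff'.
by rewrite cA -(cA g) f'f cm1 g'g.
Qed.
Lemma iso_inv (a b : K) (f : hom a b) : is_iso f ->
  exists2 g : hom b a, is_iso g & (g ∘ f = idm a /\ f ∘ g = idm b).
Proof. by move=> [g [gf fg]]; exists g => //; exists f. Qed.
Lemma isomorphic_sym (a b : K) : isomorphic a b -> isomorphic b a.
Proof. by move=> [f /iso_inv[g ig _]]; exists g. Qed.

Lemma zeroP (z : K) : is_zero_object z <-> idm z = 0.
Proof.
split=> [/(_ z)[/(_ (idm z))] //|z0 a].
by split=> f; rewrite -[f]cm1 -?z0 -[f ∘ _]c1m ?z0 ?c0m ?cm0 // cm1 -[f]c1m z0 c0m.
Qed.

Lemma zero_susp (z : K) : is_zero_object z -> is_zero_object (Σ z).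
Proof. by move=> /zeroP z0; apply/zeroP; rewrite -s1 z0 s0. Qed.

Lemma dist_comp0 (x y z : K) (u : hom x y) (v : hom y z) (w : hom z (Σ x)) :
  dist u v w -> v ∘ u = 0.
Proof.
move=> D; have [o oz] := has_zero_object Kadd.
have [|h [<- _]] := TR3 (f := idm x) (g := u) Ktri (TR1_id Ktri x oz) D _.
  by rewrite cm1.
by rewrite cm0.
Qed.

Lemma dist_comp1 (x y z : K) (u : hom x y) (v : hom y z) (w : hom z (Σ x)) :
  dist u v w -> w ∘ v = 0.
Proof. by move=> /(TR2 Ktri)/dist_comp0. Qed.

Lemma dist_comp2 (x y z : K) (u : hom x y) (v : hom y z) (w : hom z (Σ x)) :
  dist u v w -> Σ₁ u ∘ w = 0.
Proof.
move=> /(TR2 Ktri)/dist_comp1; rewrite cNl => /eqP.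
by rewrite oppr_eq0 => /eqP.
Qed.

Lemma weak_coker (x y z t : K) (u : hom x y) (v : hom y z) (w : hom z (Σ x))
    (f : hom y t) :
  dist u v w -> f ∘ u = 0 -> exists g : hom z t, f = g ∘ v.
Proof.
move=> D fu; have [o oz] := has_zero_object Kadd.
have D' : dist (0 : hom o t) (idm t) (0 : hom t (Σ o)).
  apply/(TR2 Ktri); rewrite s0 oppr0; apply: TR1_id => //; exact: zero_susp.
have [|h [hv _]] := TR3 (f := 0 : hom x o) (g := f) Ktri D D' _.
  by rewrite fu c0m.
by exists h; rewrite hv c1m.
Qed.

Lemma weak_coker1 (x y z t : K) (u : hom x y) (v : hom y z) (w : hom z (Σ x))
    (f : hom z t) :
  dist u v w -> f ∘ v = 0 -> exists g : hom (Σ x) t, f = g ∘ w.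
Proof. by move=> /(TR2 Ktri); exact: weak_coker. Qed.

(* A triangle whose first morphism is a split monomorphism splits. *)
Lemma split_triangle (a c d : K) (u : hom a c) (v : hom c d) (w : hom d (Σ a))
    (t : hom c a) :
  dist u v w -> t ∘ u = idm a ->
  exists2 s : hom d c, is_biproduct u s t v & w = 0.
Proof.
move=> D tu.
have w0 : w = 0.
  by rewrite -[w]c1m -s1 -tu sC -cA (dist_comp2 D) cm0.
have [|s sv] := weak_coker (f := idm c - u ∘ t) D.
  by rewrite cDl cNl c1m -cA tu cm1 addrN.
have vs : v ∘ s = idm d.
  have [|k] := weak_coker1 (f := v ∘ s - idm d) D.
    rewrite cDl cNl -cA -sv c1m cDr cNr cm1 cA (dist_comp0 D) c0m oppr0 addr0.
    by rewrite addrN.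
  by rewrite w0 cm0 => /eqP; rewrite subr_eq0 => /eqP.
have ts : t ∘ s = 0.
  have [|k ->] := weak_coker1 (f := t ∘ s) D; last by rewrite w0 cm0.
  by rewrite -cA -sv cDr cNr cm1 cA tu c1m addrN.
exists s => //; split=> //; first exact: dist_comp0 D.
by rewrite -sv addrC subrK.
Qed.

Section Thick.
Variable J : set K.
Hypothesis JT : is_thick J.

Lemma thick_unsusp (a : K) : J (Σ a) -> J a.
Proof. exact: (thick_susp JT a).2. Qed.

Lemma thick_dist2 (x y z : K) (u : hom x y) (v : hom y z) (w : hom z (Σ x)) :
  dist u v w -> J y -> J z -> J x.
Proof.
move=> /(TR2 Ktri) D Jy Jz; apply: thick_unsusp; exact: thick_dist D Jy Jz.
Qed.

Lemma thick_dist1 (x y z : K) (u : hom x y) (v : hom y z) (w : hom z (Σ x)) :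
  dist u v w -> J x -> J z -> J y.
Proof.
move=> /(TR2 Ktri) D Jx Jz; apply: thick_dist2 D Jz _; exact: (thick_susp JT x).1.
Qed.

Lemma thick_retract (a c : K) (i : hom a c) (p : hom c a) :
  p ∘ i = idm a -> J c -> J a.
Proof.
move=> pi Jc; have [d [v [w D]]] := TR1_cone Ktri i.
have [s B _] := split_triangle D pi.
by apply: (thick_summand JT (a := a) (b := d) (c := c)) => //; exists i, s, p, v.
Qed.

Lemma thick_direct_sum (a b c : K) : is_direct_sum a b c ->
  J c <-> J a /\ J b.
Proof.
move=> [i1 [i2 [p1 [p2 B]]]]; split.
  move=> Jc; split.
    exact: thick_retract (biprod11 B) Jc.
  exact: thick_retract (biprod22 B) Jc.
move=> [Ja Jb]; have [d [v [w D]]] := TR1_cone Ktri i1.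
have [s B' _] := split_triangle D (biprod11 B).
suff Jd : J d by exact: thick_dist1 D Ja Jd.
apply: (thick_retract (i := p2 ∘ s) (p := v ∘ i2)) Jb.
have -> : v ∘ i2 ∘ (p2 ∘ s) = v ∘ (i2 ∘ p2) ∘ s by rewrite !cA.
have -> : i2 ∘ p2 = idm c - i1 ∘ p1 by rewrite -(biprod_sum B) addrC addKr.
by rewrite cDr cNr cm1 cA (dist_comp0 D) c0m oppr0 addr0 (biprod22 B').
Qed.

(* Morphisms inverted by the Verdier quotient by J. *)
Definition cone_in (x y : K) (f : hom x y) : Prop :=
  exists2 c : K, is_cone f c & J c.

Lemma cone_id (a : K) : cone_in (idm a).
Proof.
have [o oz] := has_zero_object Kadd.
exists o; last exact: thick_zero.
by exists 0, 0; apply: TR1_id.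
Qed.

Lemma cone_comp (x y z : K) (g : hom y z) (f : hom x y) :
  cone_in f -> cone_in g -> cone_in (g ∘ f).
Proof.
move=> [c [i [i' Df]] Jc] [d [j [j' Dg]] Jd].
have [e [k [k' D]]] := TR1_cone Ktri (g ∘ f).
have [p [q [D' _ _ _ _]]] := TR4 Ktri Df Dg D.
by exists e; [exists k, k'|exact: thick_dist1 D' Jc Jd].
Qed.

Lemma cone_uniq (x y c : K) (f : hom x y) : is_cone f c -> cone_in f -> J c.
Proof.
move=> [k [k' D]] [c' [i [i' D']] Jc'].
have [d [j [j' Di]] Jd] := cone_id y.
rewrite -[f]c1m in D; have [p [q [D'' _ _ _ _]]] := TR4 Ktri D' Di D.
exact: thick_dist1 D'' Jc' Jd.
Qed.

Lemma cone_0 (a : K) : cone_in (0 : hom a a) -> J a.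
Proof.
move=> [c [v [w D]] Jc].
have [|t E] := weak_coker (f := idm a) D; first by rewrite cm0.
exact: thick_retract (esym E) Jc.
Qed.

Lemma cone_iso (x y x' y' : K) (f : hom x y) (f' : hom x' y')
    (p : hom x x') (q : hom y y') :
  is_iso p -> is_iso q -> q ∘ f = f' ∘ p -> cone_in f -> cone_in f'.
Proof.
move=> ip iq E [c [v [w D]] Jc]; exists c => //.
have [q' [qq' q'q]] := iq.
exists (v ∘ q'), (Σ₁ p ∘ w).
apply: (TR1_iso Ktri (f := p) (g := q) (h := idm c)) D => //.
- exact: iso_id.
- by rewrite c1m -cA qq' cm1.
- by rewrite cm1.
Qed.

End Thick.

Lemma t1 (a b : K) : idm a ⊗₁ idm b = idm (a ⊗ b).
Proof. exact: tensm_id. Qed.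
Lemma tC (a a' a'' b b' b'' : K) (f' : hom a' a'') (f : hom a a')
    (g' : hom b' b'') (g : hom b b') :
  (f' ⊗₁ g') ∘ (f ⊗₁ g) = (f' ∘ f) ⊗₁ (g' ∘ g).
Proof. by rewrite tensm_comp. Qed.
Lemma tDr (a a' b b' : K) (f : hom a a') (g g' : hom b b') :
  f ⊗₁ (g + g') = f ⊗₁ g + f ⊗₁ g'.
Proof.
have h := exact_add (tens_exact_l Kcompat a').
by rewrite -[f]c1m -[g + g']cm1 -tC h cDl !tC !c1m !cm1.
Qed.
Lemma tDl (a a' b b' : K) (f f' : hom a a') (g : hom b b') :
  (f + f') ⊗₁ g = f ⊗₁ g + f' ⊗₁ g.
Proof.
have h := exact_add (tens_exact_r Kcompat b').
by rewrite -[g]c1m -[f + f']cm1 -tC h cDl !tC !c1m !cm1.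
Qed.
Lemma t0r (a a' b b' : K) (f : hom a a') : f ⊗₁ (0 : hom b b') = 0.
Proof. by apply: (addrI (f ⊗₁ 0)); rewrite -tDr !addr0. Qed.
Lemma t0l (a a' b b' : K) (g : hom b b') : (0 : hom a a') ⊗₁ g = 0.
Proof. by apply: (addrI (0 ⊗₁ g)); rewrite -tDl !addr0. Qed.

Lemma iso_tens (a a' b b' : K) (f : hom a a') (g : hom b b') :
  is_iso f -> is_iso g -> is_iso (f ⊗₁ g).
Proof.
move=> [f' [ff' f'f]] [g' [gg' g'g]]; exists (f' ⊗₁ g').
by rewrite !tC ff' f'f gg' g'g !t1.
Qed.

Lemma braid_iso (a b : K) : is_iso (braid a b).
Proof. by exists (braid b a); rewrite !braid_sym. Qed.

Lemma dist_tens_l (a x y z : K) (u : hom x y) (v : hom y z) (w : hom z (Σ x)) :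
  dist u v w ->
  dist (idm a ⊗₁ u) (idm a ⊗₁ v) (rsusp a x ∘ (idm a ⊗₁ w)).
Proof. exact: (exact_dist (tens_exact_l Kcompat a)). Qed.

Lemma cone_tens_l (a x y c : K) (u : hom x y) :
  is_cone u c -> is_cone (idm a ⊗₁ u) (a ⊗ c).
Proof. by move=> [v [w D]]; exists (idm a ⊗₁ v), (rsusp a x ∘ (idm a ⊗₁ w));
  exact: dist_tens_l. Qed.

Lemma cone_tens_r (a x y c : K) (u : hom x y) :
  is_cone u c -> is_cone (u ⊗₁ idm a) (c ⊗ a).
Proof. by move=> [v [w D]]; exists (v ⊗₁ idm a), (lsusp x a ∘ (w ⊗₁ idm a));
  exact: (exact_dist (tens_exact_r Kcompat a)). Qed.

Definition intertwines (a b : K) (s : hom a b) (f : hom a a) (g : hom b b) :=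
  s ∘ f = g ∘ s.

Lemma intertwines_comp (a b c : K) (t : hom b c) (s : hom a b) f g h :
  intertwines t g h -> intertwines s f g -> intertwines (t ∘ s) f h.
Proof. by rewrite /intertwines => E1 E2; rewrite -cA E2 cA E1 cA. Qed.

Lemma intertwines_inv (a b : K) (s : hom a b) (t : hom b a) f g :
  t ∘ s = idm a /\ s ∘ t = idm b -> intertwines s f g -> intertwines t g f.
Proof.
rewrite /intertwines => -[E1 E2] E.
by rewrite -[LHS]cm1 -E2 cA -(cA t) -E cA E1 c1m.
Qed.

Lemma intertwines_id (a : K) (f : hom a a) : intertwines (idm a) f f.
Proof. by rewrite /intertwines cm1 c1m. Qed.

Lemma intertwines_tens (a b a' b' : K) (s : hom a b) (s' : hom a' b') f f' g g' :
  intertwines s f g -> intertwines s' f' g' ->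
  intertwines (s ⊗₁ s') (f ⊗₁ f') (g ⊗₁ g').
Proof. by rewrite /intertwines => E E'; rewrite !tC E E'. Qed.

Lemma intertwines_add (a b : K) (s : hom a b) f f' g g' :
  intertwines s f g -> intertwines s f' g' -> intertwines s (f + f') (g + g').
Proof. by rewrite /intertwines => E E'; rewrite cDr cDl E E'. Qed.

(* The middle-four interchange. *)
Lemma swap_iso (a b c d : K) :
  exists2 s : hom ((a ⊗ b) ⊗ (c ⊗ d)) ((a ⊗ c) ⊗ (b ⊗ d)), is_iso s &
  forall (f : hom a a) (g : hom b b) (h : hom c c) (k : hom d d),
    intertwines s ((f ⊗₁ g) ⊗₁ (h ⊗₁ k)) ((f ⊗₁ h) ⊗₁ (g ⊗₁ k)).
Proof.
have [i1 ii1 Ei1] := iso_inv (assoc_iso Kmon b c d).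
have [i2 ii2 Ei2] := iso_inv (assoc_iso Kmon a c (b ⊗ d)).
exists (i2 ∘ ((idm a ⊗₁ (assoc c b d ∘ ((braid b c ⊗₁ idm d) ∘ i1))) ∘
  assoc a b (c ⊗ d))).
  apply: iso_comp => //; apply: iso_comp; last exact: assoc_iso.
  apply: iso_tens; first exact: iso_id.
  apply: iso_comp; first exact: assoc_iso.
  by apply: iso_comp => //; apply: iso_tens; [exact: braid_iso|exact: iso_id].
move=> f g h k.
apply: (intertwines_comp (g := f ⊗₁ (h ⊗₁ (g ⊗₁ k)))).
  apply: intertwines_inv Ei2 _; exact: assoc_nat.
apply: (intertwines_comp (g := f ⊗₁ (g ⊗₁ (h ⊗₁ k)))); last exact: assoc_nat.
apply: intertwines_tens; first exact: intertwines_id.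
apply: (intertwines_comp (g := (h ⊗₁ g) ⊗₁ k)); first exact: assoc_nat.
apply: (intertwines_comp (g := (g ⊗₁ h) ⊗₁ k)).
  apply: intertwines_tens; [exact: braid_nat|exact: intertwines_id].
apply: intertwines_inv Ei1 _; exact: assoc_nat.
Qed.

(* The endomorphisms belonging to E_X. *)
Definition balanced (X : K) (f : hom X X) : Prop :=
  f ⊗₁ idm X = idm X ⊗₁ f.

Lemma balanced_iso (X Y : K) (s : hom X Y) (f : hom X X) (g : hom Y Y) :
  is_iso s -> intertwines s f g -> balanced f -> balanced g.
Proof.
move=> /iso_inv[t it [ts st]] E bf.
have [E1 E2] : intertwines (s ⊗₁ s) (f ⊗₁ idm X) (g ⊗₁ idm Y) /\
    intertwines (s ⊗₁ s) (idm X ⊗₁ f) (idm Y ⊗₁ g).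
  by split; apply: intertwines_tens => //; rewrite /intertwines cm1 c1m.
rewrite /intertwines -bf in E1 E2.
have st2 : (s ⊗₁ s) ∘ (t ⊗₁ t) = idm (Y ⊗ Y) by rewrite tC st t1.
by rewrite /balanced -[LHS]cm1 -[RHS]cm1 -st2 !cA -E1 -E2.
Qed.

Lemma balanced0 (X : K) : balanced (0 : hom X X).
Proof. by rewrite /balanced t0l t0r. Qed.
Lemma balanced1 (X : K) : balanced (idm X).
Proof. by []. Qed.
Lemma balancedD (X : K) (f g : hom X X) :
  balanced f -> balanced g -> balanced (f + g).
Proof. by rewrite /balanced tDl tDr => -> ->. Qed.
Lemma balancedN (X : K) (f : hom X X) : balanced f -> balanced (- f).
Proof.
rewrite /balanced => bf; apply: (addrI (f ⊗₁ idm X)).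
by rewrite -tDl addrN t0l bf -tDr addrN t0r.
Qed.
Lemma balancedM (X : K) (f g : hom X X) :
  balanced f -> balanced g -> balanced (f ∘ g).
Proof.
move=> bf bg; have -> : balanced (f ∘ g) =
    ((f ⊗₁ idm X) ∘ (g ⊗₁ idm X) = (idm X ⊗₁ f) ∘ (idm X ⊗₁ g)).
  by rewrite !tC !c1m.
by rewrite bf bg.
Qed.

Lemma balanced_tens (X Y : K) (f : hom X X) (g : hom Y Y) :
  balanced f -> balanced g -> balanced (f ⊗₁ g).
Proof.
move=> bf bg; have [s is_ S] := swap_iso X Y X Y.
have [t _ [ts _]] := iso_inv is_.
have E1 := S f g (idm X) (idm Y); have E2 := S (idm X) (idm Y) f g.
rewrite /intertwines -bf -bg -E1 !t1 in E2.
by rewrite /balanced -[LHS]c1m -[RHS]c1m -ts -!cA E2.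
Qed.

Lemma cone_nilpotent (X c : K) (f : hom X X) : balanced f -> is_cone f c ->
  (f ⊗₁ idm c) ∘ (f ⊗₁ idm c) = 0.
Proof.
move=> bf [v [w D]]; have D' := dist_tens_l X D.
have [|t E] := weak_coker1 (f := f ⊗₁ idm c) D'.
  by rewrite tC c1m cm1 -[f]c1m -[v]cm1 -tC bf (dist_comp0 D') // .
have E' : rsusp X X ∘ (idm X ⊗₁ w) ∘ (f ⊗₁ idm c) =
    Σ₁ (f ⊗₁ idm X) ∘ (rsusp X X ∘ (idm X ⊗₁ w)).
  by rewrite cA -(rsusp_nat Kcompat) s1 -!cA !tC !c1m !cm1.
by rewrite {1}E -cA E' bf (dist_comp2 D') cm0.
Qed.

End Theory.

Section SpcTopology.
Variable K : tt_category.

Lemma tt_preadditive : preadditive_axioms K.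
Proof.
exact: additive_preadditive (triangulated_additive (tt_triangulated (ttP K))).
Qed.

Lemma spc_thick (P : Spc K) : is_thick P.
Proof. exact: ideal_thick (prime_ideal (spcP P)). Qed.

Lemma prime_unit (P : Spc K) : ~ spc_set P 𝟙.
Proof.
have [PI [a Pa] _] := spcP P => P1; apply: Pa.
apply: (thick_iso (ideal_thick PI) (a := a ⊗ 𝟙)).
  by exists (runit a); exact: (runit_iso (tt_monoidal (ttP K))).
exact: ideal_tens.
Qed.

Lemma prime_tensE (P : Spc K) (a b : K) :
  spc_set P (a ⊗ b) <-> spc_set P a \/ spc_set P b.
Proof.
split; first exact: (prime_tens (spcP P)).
by have PI := prime_ideal (spcP P) => -[]; [exact: ideal_tens_r|exact: ideal_tens].
Qed.

Let spc_openT : @spc_open K setT.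
Proof.
have [z zz] := has_zero_object (triangulated_additive (tt_triangulated (ttP K))).
move=> P _; exists z; split=> //; apply; exact: (thick_zero (spc_thick P)).
Qed.

Let spc_openI : setI_closed (@spc_open K).
Proof.
move=> U V oU oV P [/oU[a [Pa aU]] /oV[b [Pb bV]]].
have [c abc] := has_direct_sums
  (triangulated_additive (tt_triangulated (ttP K))) a b.
have E (Q : Spc K) := thick_direct_sum (spc_thick Q) abc.
exists c; split.
  by rewrite /supp /= => nc; apply: nc; apply/E; split; apply: contrapT.
move=> Q /= /contrapT/E[Qa Qb].
by split; [apply: aU|apply: bV] => /=; rewrite notK.
Qed.

Let spc_open_bigU (I : Type) (f : I -> set (Spc K)) :
  (forall i, spc_open (f i)) -> spc_open (\bigcup_i f i).
Proof.
move=> of_ P [i _ /of_[a [Pa af]]]; exists a; split=> //.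
by move=> Q /af fQ; exists i.
Qed.

HB.instance Definition _ := isOpenTopological.Build (Spc K)
  spc_openT spc_openI spc_open_bigU.

End SpcTopology.

(* A may be the zero ring (it is when Z is empty), so the library's prime
   ideals, restricted to nontrivial rings, do not apply. *)
Record is_prime_ideal (A : comPzRingType) (I : set A) : Prop := IsPrimeIdeal {
  pideal0 : I 0;
  pidealD : forall x y : A, I x -> I y -> I (x + y);
  pidealM : forall x y : A, I y -> I (x * y);
  pideal1 : ~ I 1;
  pideal_prime : forall x y : A, I (x * y) -> I x \/ I y
}.

Record Spec (A : comPzRingType) := MkSpec {
  spec_set :> set A;
  specP : is_prime_ideal spec_set
}.

HB.instance Definition _ (A : comPzRingType) := gen_eqMixin (Spec A).
HB.instance Definition _ (A : comPzRingType) := gen_choiceMixin (Spec A).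

Definition spec_basic (A : comPzRingType) (x : A) : set (Spec A) :=
  [set p : Spec A | ~ spec_set p x].

Definition spec_open (A : comPzRingType) : set_system (Spec A) :=
  [set U | forall p, U p -> exists x : A, spec_basic x p /\ spec_basic x `<=` U].

Section SpecTopology.
Variable A : comPzRingType.

Let spec_openT : spec_open (setT : set (Spec A)).
Proof. by move=> p _; exists 1; split=> //; exact: pideal1 (specP p). Qed.

Let spec_openI : setI_closed (@spec_open A).
Proof.
move=> U V oU oV p [/oU[x [px xU]] /oV[y [py yV]]].
exists (x * y); split.
  by move=> /(pideal_prime (specP p))[].
move=> q qxy; split; [apply: xU|apply: yV] => qz; apply: qxy.
  by rewrite mulrC; exact: pidealM (specP q) _ _ qz.
exact: pidealM (specP q) _ _ qz.
Qed.

Let spec_open_bigU (I : Type) (f : I -> set (Spec A)) :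
  (forall i, spec_open (f i)) -> spec_open (\bigcup_i f i).
Proof.
move=> of_ p [i _ /of_[a [pa af]]]; exists a; split=> //.
by move=> q /af fq; exists i.
Qed.

HB.instance Definition _ := isOpenTopological.Build (Spec A)
  spec_openT spec_openI spec_open_bigU.

End SpecTopology.

Section SpecMap.
Variables (A B : comPzRingType) (h : {rmorphism A -> B}).

Lemma spec_map_subproof (q : Spec B) : is_prime_ideal (h @^-1` spec_set q).
Proof.
have [q0 qD qM q1 qP] := specP q; split=> /=.
- by rewrite rmorph0.
- by move=> x y qx qy; rewrite rmorphD; exact: qD.
- by move=> x y qy; rewrite rmorphM; exact: qM.
- by rewrite rmorph1.
- by move=> x y; rewrite rmorphM; exact: qP.
Qed.

Definition Spec_map (q : Spec B) : Spec A := MkSpec (spec_map_subproof q).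

End SpecMap.

Definition irreducible_closed (T : topologicalType) (C : set T) : Prop :=
  [/\ closed C, C !=set0 &
      forall A B : set T, closed A -> closed B ->
        C `<=` A `|` B -> C `<=` A \/ C `<=` B].

Record is_spectral_space (T : topologicalType) : Prop := IsSpectralSpace {
  spectral_compact : compact [set: T];
  spectral_compactI : forall U V : set T,
    open U -> compact U -> open V -> compact V -> compact (U `&` V);
  spectral_basis : forall (x : T) (W : set T), open W -> W x ->
    exists U : set T, [/\ open U, compact U, U x & U `<=` W];
  spectral_sober : forall C : set T, irreducible_closed C ->
    exists! x : T, closure [set x] = C
}.

Definition is_spectral_map (S T : topologicalType) (f : S -> T) : Prop :=
  continuous f /\
  forall U : set T, open U -> compact U -> compact (f @^-1` U).

Definition is_spectral_pullback (P X Y B : topologicalType)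
    (p : P -> X) (q : P -> Y) (f : X -> B) (g : Y -> B) : Prop :=
  f \o p =1 g \o q /\
  forall (T : topologicalType) (u : T -> X) (v : T -> Y),
    is_spectral_space T -> is_spectral_map u -> is_spectral_map v ->
    f \o u =1 g \o v ->
    exists! w : T -> P, [/\ is_spectral_map w, p \o w =1 u & q \o w =1 v].

Section RingOfEndomorphisms.
Variables (K : tt_category) (Z : set (Spc K)).

Let Kmon : monoidal_axioms K := tt_monoidal (ttP K).

(* The set Φ attached to Z. *)
Definition supp_above : set K := [set a | Z `<=` supp a].

Lemma supp_above_tens (a b : K) :
  supp_above a -> supp_above b -> supp_above (a ⊗ b).
Proof. by move=> Za Zb P ZP /prime_tensE[]; [exact: Za|exact: Zb]. Qed.

Lemma supp_above_unit : supp_above 𝟙.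
Proof. by move=> P _; exact: prime_unit. Qed.

(* Pairs (X, f) with X in Φ and f in E_X. *)
Record rep := Rep {
  rep_ob : K;
  rep_map : hom rep_ob rep_ob;
  rep_supp : supp_above rep_ob;
  rep_balanced : balanced rep_map
}.
Arguments rep_supp : clear implicits.

HB.instance Definition _ := gen_eqMixin rep.
HB.instance Definition _ := gen_choiceMixin rep.

Definition rep_tens_l (a : K) (Za : supp_above a) (x : rep) : rep :=
  Rep (supp_above_tens Za (rep_supp x))
      (balanced_tens (balanced1 a) (rep_balanced x)).

Definition rep_tens_r (x : rep) (a : K) (Za : supp_above a) : rep :=
  Rep (supp_above_tens (rep_supp x) Za)
      (balanced_tens (rep_balanced x) (balanced1 a)).

Inductive rep_step : rep -> rep -> Prop :=
| RepStepL x a (Za : supp_above a) : rep_step x (rep_tens_l Za x)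
| RepStepR x a (Za : supp_above a) : rep_step x (rep_tens_r x Za).

Definition rep_eq : rep -> rep -> Prop := clos_refl_sym_trans rep rep_step.

Definition rep_eqb : rel rep := fun x y => `[< rep_eq x y >].

Let rep_eqb_refl : reflexive rep_eqb.
Proof. by move=> x; apply/asboolP; exact: rst_refl. Qed.
Let rep_eqb_sym : symmetric rep_eqb.
Proof. by move=> x y; apply/asbool_equiv_eq; split; exact: rst_sym. Qed.
Let rep_eqb_trans : transitive rep_eqb.
Proof.
move=> y x z /asboolP xy /asboolP yz; apply/asboolP; exact: rst_trans xy yz.
Qed.

Canonical rep_equiv := EquivRel rep_eqb rep_eqb_refl rep_eqb_sym rep_eqb_trans.

(* The ring R_{K,Z}; its operations are computed on representatives by er_addE
   and er_mulE. *)
Definition endo_ring : Type := {eq_quot rep_equiv}.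
HB.instance Definition _ := Choice.on endo_ring.
HB.instance Definition _ := EqQuotient.on endo_ring.

Definition rep_class (x : rep) : endo_ring := \pi x.

Lemma rep_classP (x y : rep) : rep_class x = rep_class y <-> rep_eq x y.
Proof.
split=> [E|E]; last by apply/eqmodP/asboolP.
by apply/asboolP; apply/(@eqmodP _ rep_equiv).
Qed.

Lemma rep_class_surj (r : endo_ring) : exists x, r = rep_class x.
Proof. by exists (repr r); rewrite /rep_class reprK. Qed.

Definition rep_add (x y : rep) : rep :=
  Rep (supp_above_tens (rep_supp x) (rep_supp y))
      (balancedD (balanced_tens (rep_balanced x) (balanced1 (rep_ob y)))
                 (balanced_tens (balanced1 (rep_ob x)) (rep_balanced y))).

Definition rep_mul (x y : rep) : rep :=
  Rep (supp_above_tens (rep_supp x) (rep_supp y))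
      (balancedM (balanced_tens (rep_balanced x) (balanced1 (rep_ob y)))
                 (balanced_tens (balanced1 (rep_ob x)) (rep_balanced y))).

Definition rep_opp (x : rep) : rep :=
  Rep (rep_supp x) (balancedN (rep_balanced x)).
Definition rep_zero : rep := Rep supp_above_unit (balanced0 𝟙).
Definition rep_one : rep := Rep supp_above_unit (balanced1 𝟙).

Lemma Rep_ext (X : K) (f g : hom X X) p q p' q' :
  f = g -> @Rep X f p q = @Rep X g p' q'.
Proof.
by move=> E; subst g; rewrite (Prop_irrelevance p p') (Prop_irrelevance q q').
Qed.

Lemma class_tens_l a (Za : supp_above a) x :
  rep_class (rep_tens_l Za x) = rep_class x.
Proof. by apply/rep_classP/rst_sym/rst_step; constructor. Qed.

Lemma class_tens_r a (Za : supp_above a) x :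
  rep_class (rep_tens_r x Za) = rep_class x.
Proof. by apply/rep_classP/rst_sym/rst_step; constructor. Qed.

Lemma class_iso (x y : rep) (s : hom (rep_ob x) (rep_ob y)) :
  is_iso s -> intertwines s (rep_map x) (rep_map y) ->
  rep_class x = rep_class y.
Proof.
move=> [t [ts st]] E.
rewrite -(class_tens_r (rep_supp y) x) -(class_tens_l (rep_supp x) y).
congr rep_class; apply: Rep_ext.
have E1 : intertwines (idm (rep_ob x) ⊗₁ s)
    (rep_map x ⊗₁ idm _) (rep_map x ⊗₁ idm _).
  by apply: intertwines_tens; rewrite /intertwines ?c1m ?cm1.
have E2 : intertwines (idm (rep_ob x) ⊗₁ s)
    (idm _ ⊗₁ rep_map x) (idm _ ⊗₁ rep_map y).
  by apply: intertwines_tens; rewrite // /intertwines ?c1m ?cm1.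
have st2 : (idm (rep_ob x) ⊗₁ s) ∘ (idm (rep_ob x) ⊗₁ t) = idm _.
  by rewrite tC st c1m t1.
rewrite /intertwines (rep_balanced x) E2 in E1.
by rewrite -[LHS]cm1 -[RHS]cm1 -st2 !cA E1.
Qed.

Lemma class_ind_eq (op : rep -> rep) :
  (forall x a (Za : supp_above a),
     rep_class (op (rep_tens_l Za x)) = rep_class (op x)) ->
  (forall x a (Za : supp_above a),
     rep_class (op (rep_tens_r x Za)) = rep_class (op x)) ->
  forall x y, rep_class x = rep_class y -> rep_class (op x) = rep_class (op y).
Proof.
move=> Hl Hr x y /rep_classP; elim=> {x y} //.
- by move=> x y []; symmetry; [exact: Hl|exact: Hr].
- by move=> x y z _ -> _ ->.
Qed.

Lemma braid_tens_rl a (Za : supp_above a) x :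
  intertwines (braid (rep_ob x) a)
    (rep_map (rep_tens_r x Za)) (rep_map (rep_tens_l Za x)).
Proof. exact: braid_nat. Qed.

Lemma class_add_iso x x' y (s : hom (rep_ob x) (rep_ob x')) :
  is_iso s -> intertwines s (rep_map x) (rep_map x') ->
  rep_class (rep_add x y) = rep_class (rep_add x' y).
Proof.
move=> is_ E; apply: (class_iso (x := rep_add x y) (y := rep_add x' y)
    (s := s ⊗₁ idm (rep_ob y))).
  by apply: iso_tens => //; exact: iso_id.
by apply: intertwines_add; apply: intertwines_tens; rewrite // /intertwines ?c1m ?cm1.
Qed.

Lemma class_addC x y : rep_class (rep_add x y) = rep_class (rep_add y x).
Proof.
apply: (class_iso (x := rep_add x y) (y := rep_add y x)
    (s := braid (rep_ob x) (rep_ob y))); first exact: braid_iso.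
by rewrite /= [X in intertwines _ _ X]addrC; apply: intertwines_add; exact: braid_nat.
Qed.

Lemma class_add_l x x' y : rep_class x = rep_class x' ->
  rep_class (rep_add x y) = rep_class (rep_add x' y).
Proof.
have H a (Za : supp_above a) z :
    rep_class (rep_add (rep_tens_l Za z) y) = rep_class (rep_add z y).
  rewrite -[RHS](class_tens_l Za).
  apply: (class_iso (x := rep_add (rep_tens_l Za z) y)
    (y := rep_tens_l Za (rep_add z y))
    (s := assoc a (rep_ob z) (rep_ob y))); first exact: assoc_iso.
  rewrite /= tDr -t1; apply: intertwines_add; exact: assoc_nat.
move: x x'; apply: (class_ind_eq (op := fun x => rep_add x y)) => x a Za //.
rewrite (class_add_iso (x := rep_tens_r x Za) (x' := rep_tens_l Za x) y
  (s := braid (rep_ob x) a)) //; [exact: braid_iso|exact: braid_tens_rl].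
Qed.

Lemma class_add x x' y y' :
  rep_class x = rep_class x' -> rep_class y = rep_class y' ->
  rep_class (rep_add x y) = rep_class (rep_add x' y').
Proof.
by move=> /(class_add_l y) -> /(class_add_l x') E; rewrite class_addC E class_addC.
Qed.

Lemma mul_tens (x y : rep) :
  rep_map (rep_mul x y) = rep_map x ⊗₁ rep_map y.
Proof. by rewrite /= tC c1m cm1. Qed.

Lemma class_mul_iso x x' y (s : hom (rep_ob x) (rep_ob x')) :
  is_iso s -> intertwines s (rep_map x) (rep_map x') ->
  rep_class (rep_mul x y) = rep_class (rep_mul x' y).
Proof.
move=> is_ E; apply: (class_iso (x := rep_mul x y) (y := rep_mul x' y)
    (s := s ⊗₁ idm (rep_ob y))).
  by apply: iso_tens => //; exact: iso_id.
rewrite !mul_tens.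
by apply: intertwines_tens; rewrite // /intertwines ?c1m ?cm1.
Qed.

Lemma class_mulC x y : rep_class (rep_mul x y) = rep_class (rep_mul y x).
Proof.
apply: (class_iso (x := rep_mul x y) (y := rep_mul y x)
    (s := braid (rep_ob x) (rep_ob y))); first exact: braid_iso.
rewrite !mul_tens; exact: braid_nat.
Qed.

Lemma class_mul_l x x' y : rep_class x = rep_class x' ->
  rep_class (rep_mul x y) = rep_class (rep_mul x' y).
Proof.
have H a (Za : supp_above a) z :
    rep_class (rep_mul (rep_tens_l Za z) y) = rep_class (rep_mul z y).
  rewrite -[RHS](class_tens_l Za).
  apply: (class_iso (x := rep_mul (rep_tens_l Za z) y) (y := rep_tens_l Za (rep_mul z y))
    (s := assoc a (rep_ob z) (rep_ob y))).
    exact: assoc_iso.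
  rewrite /= !tC !c1m !cm1; exact: assoc_nat.
move: x x'; apply: (class_ind_eq (op := fun x => rep_mul x y)) => x a Za //.
rewrite (class_mul_iso (x := rep_tens_r x Za) (x' := rep_tens_l Za x) y
  (s := braid (rep_ob x) a)) //; [exact: braid_iso|exact: braid_tens_rl].
Qed.

Lemma class_mul x x' y y' :
  rep_class x = rep_class x' -> rep_class y = rep_class y' ->
  rep_class (rep_mul x y) = rep_class (rep_mul x' y').
Proof.
by move=> /(class_mul_l y) -> /(class_mul_l x') E; rewrite class_mulC E class_mulC.
Qed.

Definition er_add (r s : endo_ring) : endo_ring :=
  rep_class (rep_add (repr r) (repr s)).
Definition er_mul (r s : endo_ring) : endo_ring :=
  rep_class (rep_mul (repr r) (repr s)).
Definition er_opp (r : endo_ring) : endo_ring := rep_class (rep_opp (repr r)).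
Definition er_zero : endo_ring := rep_class rep_zero.
Definition er_one : endo_ring := rep_class rep_one.

Lemma repr_class x : rep_class (repr (rep_class x)) = rep_class x.
Proof. by rewrite /rep_class reprK. Qed.

Lemma er_addE x y :
  er_add (rep_class x) (rep_class y) = rep_class (rep_add x y).
Proof. by apply: class_add; exact: repr_class. Qed.
Lemma er_mulE x y :
  er_mul (rep_class x) (rep_class y) = rep_class (rep_mul x y).
Proof. by apply: class_mul; exact: repr_class. Qed.
Lemma er_oppE x : er_opp (rep_class x) = rep_class (rep_opp x).
Proof.
apply: (class_ind_eq (op := rep_opp)) (repr_class x) => {}x a Za.
  rewrite -[RHS](class_tens_l Za); congr rep_class; apply: Rep_ext => /=.
  by apply: (addrI (idm a ⊗₁ rep_map x)); rewrite -tDr !addrN t0r.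
rewrite -[RHS](class_tens_r Za); congr rep_class; apply: Rep_ext => /=.
by apply: (addrI (rep_map x ⊗₁ idm a)); rewrite -tDl !addrN t0l.
Qed.

(* Any finite family of classes is represented on a common object, where the
   operations are those of the endomorphism ring. *)
Lemma common_rep (r s t : endo_ring) : exists (X : K) (ZX : supp_above X)
    (f g h : hom X X) (bf : balanced f) (bg : balanced g) (bh : balanced h),
  [/\ r = rep_class (Rep ZX bf), s = rep_class (Rep ZX bg) &
      t = rep_class (Rep ZX bh)].
Proof.
have [[X f ZX bf] ->] := rep_class_surj r.
have [[Y g ZY bg] ->] := rep_class_surj s.
have [[W h ZW bh] ->] := rep_class_surj t.
exists ((X ⊗ Y) ⊗ W), (supp_above_tens (supp_above_tens ZX ZY) ZW).
exists ((f ⊗₁ idm Y) ⊗₁ idm W), ((idm X ⊗₁ g) ⊗₁ idm W), (idm (X ⊗ Y) ⊗₁ h).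
exists (balanced_tens (balanced_tens bf (balanced1 Y)) (balanced1 W)).
exists (balanced_tens (balanced_tens (balanced1 X) bg) (balanced1 W)).
exists (balanced_tens (balanced1 (X ⊗ Y)) bh); split.
- rewrite -(class_tens_r ZY) -(class_tens_r ZW); congr rep_class; exact: Rep_ext.
- rewrite -(class_tens_l ZX) -(class_tens_r ZW); congr rep_class; exact: Rep_ext.
- rewrite -(class_tens_l (supp_above_tens ZX ZY)); congr rep_class; exact: Rep_ext.
Qed.

Section SameObject.
Variables (X : K) (ZX : supp_above X).

Lemma er_add_same (f g : hom X X) (bf : balanced f) (bg : balanced g) :
  er_add (rep_class (Rep ZX bf)) (rep_class (Rep ZX bg)) =
  rep_class (Rep ZX (balancedD bf bg)).
Proof.
rewrite er_addE -[RHS](class_tens_r ZX); congr rep_class; apply: Rep_ext => /=.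
by rewrite -bg tDl.
Qed.

Lemma er_mul_same (f g : hom X X) (bf : balanced f) (bg : balanced g) :
  er_mul (rep_class (Rep ZX bf)) (rep_class (Rep ZX bg)) =
  rep_class (Rep ZX (balancedM bf bg)).
Proof.
rewrite er_mulE -[RHS](class_tens_r ZX); congr rep_class; apply: Rep_ext => /=.
by rewrite -bg tC c1m.
Qed.

Lemma er_zero_same : er_zero = rep_class (Rep ZX (balanced0 X)).
Proof.
rewrite /er_zero -(class_tens_l ZX) -[RHS](class_tens_r supp_above_unit).
by congr rep_class; apply: Rep_ext => /=; rewrite t0l t0r.
Qed.

Lemma er_one_same : er_one = rep_class (Rep ZX (balanced1 X)).
Proof.
rewrite /er_one -(class_tens_l ZX) -[RHS](class_tens_r supp_above_unit).
by congr rep_class; apply: Rep_ext.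
Qed.

End SameObject.

Lemma er_addA : associative er_add.
Proof.
move=> r s t; have [X [ZX [f [g [h [bf [bg [bh [-> -> ->]]]]]]]]] :=
  common_rep r s t.
by rewrite !er_add_same; congr rep_class; apply: Rep_ext; rewrite addrA.
Qed.

Lemma er_addC : commutative er_add.
Proof.
move=> r s; have [x ->] := rep_class_surj r; have [y ->] := rep_class_surj s.
by rewrite !er_addE class_addC.
Qed.

Lemma er_add0 : left_id er_zero er_add.
Proof.
move=> r; have [[X f ZX bf] ->] := rep_class_surj r.
by rewrite (er_zero_same ZX) er_add_same; congr rep_class; apply: Rep_ext;
  rewrite add0r.
Qed.

Lemma er_addN : left_inverse er_zero er_opp er_add.
Proof.
move=> r; have [[X f ZX bf] ->] := rep_class_surj r.
rewrite (er_zero_same ZX) er_oppE er_add_same; congr rep_class.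
by apply: Rep_ext; rewrite addNr.
Qed.

Lemma er_mulA : associative er_mul.
Proof.
move=> r s t; have [X [ZX [f [g [h [bf [bg [bh [-> -> ->]]]]]]]]] :=
  common_rep r s t.
by rewrite !er_mul_same; congr rep_class; apply: Rep_ext; rewrite cA.
Qed.

Lemma er_mulC : commutative er_mul.
Proof.
move=> r s; have [x ->] := rep_class_surj r; have [y ->] := rep_class_surj s.
by rewrite !er_mulE class_mulC.
Qed.

Lemma er_mul1 : left_id er_one er_mul.
Proof.
move=> r; have [[X f ZX bf] ->] := rep_class_surj r.
by rewrite (er_one_same ZX) er_mul_same; congr rep_class; apply: Rep_ext;
  rewrite c1m.
Qed.

Lemma er_mulDl : left_distributive er_mul er_add.
Proof.
move=> r s t; have [X [ZX [f [g [h [bf [bg [bh [-> -> ->]]]]]]]]] :=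
  common_rep r s t.
by rewrite !er_mul_same !er_add_same !er_mul_same; congr rep_class;
  apply: Rep_ext; rewrite cDl.
Qed.

HB.instance Definition _ := GRing.isZmodule.Build endo_ring
  er_addA er_addC er_add0 er_addN.
HB.instance Definition _ := GRing.Zmodule_isComPzRing.Build endo_ring
  er_mulA er_mulC er_mul1 er_mulDl.

End RingOfEndomorphisms.
Arguments rep_supp {K Z} r P _ : rename.

Section Comparison.
Variables (K : tt_category) (Z : set (Spc K)).

Definition rho_set (P : Spc K) : set (endo_ring Z) :=
  [set r | exists (x : rep Z) (c : K),
     [/\ r = rep_class x, is_cone (rep_map x) c & ~ spc_set P c]].

Variable P : Spc K.
Hypothesis ZP : Z P.

Let PT : is_thick P := spc_thick P.
Let Ktri : triangle_axioms K :=
  triangulated_triangles (tt_triangulated (ttP K)).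

Lemma supp_aboveN (a : K) : supp_above Z a -> ~ spc_set P a.
Proof. by apply. Qed.

Lemma cone_in_tens_l (a X Y : K) (f : hom X Y) : cone_in P f ->
  cone_in P (idm a ⊗₁ f).
Proof.
move=> [c Cc Pc]; exists (a ⊗ c); first exact: cone_tens_l.
by apply/prime_tensE; right.
Qed.

Lemma cone_in_tens_r (a X Y : K) (f : hom X Y) : cone_in P f ->
  cone_in P (f ⊗₁ idm a).
Proof.
move=> [c Cc Pc]; exists (c ⊗ a); first exact: cone_tens_r.
by apply/prime_tensE; left.
Qed.

Lemma cone_in_tens_lE (a X Y : K) (f : hom X Y) : ~ spc_set P a ->
  cone_in P (idm a ⊗₁ f) <-> cone_in P f.
Proof.
move=> Pa; split; last exact: cone_in_tens_l.
move=> H; have [c [v [w D]]] := TR1_cone Ktri f.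
have Cf : is_cone f c by exists v, w.
exists c => //.
by have /prime_tensE[] := cone_uniq PT (cone_tens_l a Cf) H.
Qed.

Lemma cone_in_tens_rE (a X Y : K) (f : hom X Y) : ~ spc_set P a ->
  cone_in P (f ⊗₁ idm a) <-> cone_in P f.
Proof.
move=> Pa; split; last exact: cone_in_tens_r.
move=> H; have [c [v [w D]]] := TR1_cone Ktri f.
have Cf : is_cone f c by exists v, w.
exists c => //.
by have /prime_tensE[] := cone_uniq PT (cone_tens_r a Cf) H.
Qed.

Lemma rho_setP (x : rep Z) :
  rho_set P (rep_class x) <-> ~ cone_in P (rep_map x).
Proof.
split.
  move=> [y [c [/rep_classP xy Cc Pc]]].
  have -> : cone_in P (rep_map x) <-> cone_in P (rep_map y).
    elim: xy => {x y c Cc Pc} //.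
    - move=> x y [{}x|{}x] a Za /=; symmetry.
        exact/cone_in_tens_lE/supp_aboveN.
      exact/cone_in_tens_rE/supp_aboveN.
    - by move=> x y _ E; symmetry.
    - by move=> x y z _ -> _ ->.
  by move=> /(cone_uniq PT Cc).
move=> N; have [c [v [w D]]] := TR1_cone Ktri (rep_map x).
have Cf : is_cone (rep_map x) c by exists v, w.
by exists x, c; split=> // Pc; apply: N; exists c.
Qed.

Lemma square_zero_l (X Y c d : K) (f : hom X X) (bf : balanced f)
    (g : hom Y Y) : is_cone f c ->
  ((f ⊗₁ g) ⊗₁ idm (c ⊗ d)) ∘ ((f ⊗₁ g) ⊗₁ idm (c ⊗ d)) = 0.
Proof.
move=> Cf; have [s is_ S] := swap_iso X Y c d.
have [t _ [ts _]] := iso_inv is_.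
have := S f g (idm c) (idm d); rewrite /intertwines t1.
set A := _ ⊗₁ idm (c ⊗ d) => E.
have sAA : s ∘ (A ∘ A) = 0 by rewrite cA E -cA E cA tC cone_nilpotent // t0l c0m.
by rewrite -[LHS]c1m -ts -cA sAA cm0.
Qed.

Lemma square_zero_r (X Y c d : K) (f : hom X X) (g : hom Y Y)
    (bg : balanced g) : is_cone g d ->
  ((f ⊗₁ g) ⊗₁ idm (c ⊗ d)) ∘ ((f ⊗₁ g) ⊗₁ idm (c ⊗ d)) = 0.
Proof.
move=> Cf; have [s is_ S] := swap_iso X Y c d.
have [t _ [ts _]] := iso_inv is_.
have := S f g (idm c) (idm d); rewrite /intertwines t1.
set A := _ ⊗₁ idm (c ⊗ d) => E.
have sAA : s ∘ (A ∘ A) = 0 by rewrite cA E -cA E cA tC (cone_nilpotent bg) // t0r c0m.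
by rewrite -[LHS]c1m -ts -cA sAA cm0.
Qed.

Lemma rho_prime : is_prime_ideal (rho_set P).
Proof.
have cone_ex (X : K) (f : hom X X) : exists c, is_cone f c.
  by have [c [v [w D]]] := TR1_cone Ktri f; exists c, v, w.
split.
- apply/rho_setP => /(cone_0 PT); exact: prime_unit.
- move=> r s; have [x ->] := rep_class_surj r; have [y ->] := rep_class_surj s.
  have -> : rep_class x + rep_class y = rep_class (rep_add x y).
    exact: er_addE.
  move=> /rho_setP Nx /rho_setP Ny; apply/rho_setP => Nxy.
  have [c Cc] := cone_ex _ (rep_map x); have [d Cd] := cone_ex _ (rep_map y).
  have Pc : ~ spc_set P c by move=> Pc; apply: Nx; exists c.
  have Pd : ~ spc_set P d by move=> Pd; apply: Ny; exists d.
  set X := rep_ob x in Cc *; set Y := rep_ob y in Cd *.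
  pose p := (rep_map x ⊗₁ idm Y) ⊗₁ idm (c ⊗ d).
  pose q := (idm X ⊗₁ rep_map y) ⊗₁ idm (c ⊗ d).
  have pp : p ∘ p = 0 by apply: square_zero_l => //; exact: rep_balanced.
  have qq : q ∘ q = 0 by apply: square_zero_r => //; exact: rep_balanced.
  have pq : p ∘ q = q ∘ p by rewrite /p /q !tC !c1m !cm1.
  have H : cone_in P (p + q) by rewrite -tDl; exact: cone_in_tens_r.
  have Z3 : (p + q) ∘ ((p + q) ∘ (p + q)) = 0.
    have -> : (p + q) ∘ (p + q) = p ∘ q + p ∘ q.
      by rewrite cDr !cDl pp qq add0r addr0 -pq.
    have ppq : p ∘ (p ∘ q) = 0 by rewrite cA pp c0m.
    have qpq : q ∘ (p ∘ q) = 0 by rewrite pq cA qq c0m.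
    by rewrite cDr !cDl ppq qpq !addr0.
  have : cone_in P (0 : hom ((X ⊗ Y) ⊗ (c ⊗ d)) ((X ⊗ Y) ⊗ (c ⊗ d))).
    by rewrite -Z3; do !apply: (cone_comp PT).
  move=> /(cone_0 PT)/prime_tensE[]/prime_tensE[] //; apply: supp_aboveN;
    exact: rep_supp.
- move=> r s; have [x ->] := rep_class_surj r; have [y ->] := rep_class_surj s.
  rewrite mulrC; have -> : rep_class y * rep_class x = rep_class (rep_mul y x).
    exact: er_mulE.
  move=> /rho_setP Ny; apply/rho_setP => Nxy.
  have [c Cc] := cone_ex _ (rep_map y).
  have Pc : ~ spc_set P c by move=> Pc; apply: Ny; exists c.
  have H := cone_in_tens_r (c ⊗ 𝟙) Nxy; rewrite mul_tens in H.
  have := cone_comp PT H H; rewrite square_zero_l //; last exact: rep_balanced.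
  move=> /(cone_0 PT)/prime_tensE[]/prime_tensE[] //; last exact: prime_unit.
    by apply: supp_aboveN; exact: rep_supp.
  by apply: supp_aboveN; exact: rep_supp.
- by move/rho_setP; apply; exact: cone_id.
- move=> r s; have [x ->] := rep_class_surj r; have [y ->] := rep_class_surj s.
  have -> : rep_class x * rep_class y = rep_class (rep_mul x y).
    exact: er_mulE.
  move=> /rho_setP N; apply: contrapT => /not_orP[].
  move=> /rho_setP/contrapT Hx /rho_setP/contrapT Hy; apply: N.
  by apply: cone_comp => //; [exact: cone_in_tens_l|exact: cone_in_tens_r].
Qed.

End Comparison.

Definition rho (K : tt_category) (Z : set (Spc K)) (P : Z) :
    Spec (endo_ring Z) :=
  MkSpec (rho_prime (set_valP P)).
Arguments rho {K} Z P.

Section Functoriality.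
Variables (K L : tt_category) (F : tt_functor K L).

Let Fex : is_exact_functor (@fmap K L F) (fsusp F) := functor_exact (ttfP F).

Lemma fmap_id (a : K) : fmap F (idm a) = idm (F a).
Proof. exact: exact_id Fex a. Qed.
Lemma fmap_comp (a b c : K) (g : hom b c) (f : hom a b) :
  fmap F (g ∘ f) = fmap F g ∘ fmap F f.
Proof. exact: exact_comp Fex _ _ _ g f. Qed.
Lemma fmap_add (a b : K) (f g : hom a b) :
  fmap F (f + g) = fmap F f + fmap F g.
Proof. exact: exact_add Fex _ _ f g. Qed.
Lemma fmap0 (a b : K) : fmap F (0 : hom a b) = 0.
Proof. by apply: (addrI (fmap F 0)); rewrite -fmap_add !addr0. Qed.

Lemma fmap_iso (a b : K) (f : hom a b) : is_iso f -> is_iso (fmap F f).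
Proof.
by move=> [g [gf fg]]; exists (fmap F g); rewrite -!fmap_comp gf fg !fmap_id.
Qed.

Lemma fob_tens (a b : K) : isomorphic (F a ⊗ F b) (F (a ⊗ b)).
Proof. by exists (fmul F a b); exact: fmul_iso (ttfP F) a b. Qed.

Lemma preimage_prime (P : Spc L) : is_prime [set a : K | spc_set P (F a)].
Proof.
have PT := spc_thick P; have PI := prime_ideal (spcP P).
have PE (a b : K) : spc_set P (F (a ⊗ b)) <-> spc_set P (F a ⊗ F b).
  by split; apply: (thick_iso PT); [apply: isomorphic_sym|]; exact: fob_tens.
split.
- split; first split.
  + move=> z /zeroP z0 /=; apply: (thick_zero PT); apply/zeroP.
    by rewrite -fmap_id z0 fmap0.
  + move=> a b [f /fmap_iso fi] /=; apply: (thick_iso PT); by exists (fmap F f).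
  + have si (a : K) : isomorphic (F (Σ a)) (Σ (F a)).
      by exists (fsusp F a); exact: (exact_susp_iso Fex).
    move=> a /=; split=> [Pa|Pa].
      apply: (thick_iso PT) (isomorphic_sym (si a)) _.
      exact: (thick_susp PT (F a)).1.
    exact/(thick_susp PT (F a)).2/(thick_iso PT (si a)).
  + move=> x y z u v w /(exact_dist Fex) D /=; exact: thick_dist D.
  + move=> a b c [i1 [i2 [p1 [p2 [E1 E2 E3 E4 E5]]]]] /=.
    apply: (thick_summand PT (b := F b)).
    exists (fmap F i1), (fmap F i2), (fmap F p1), (fmap F p2).
    by split; rewrite -!fmap_comp ?E1 ?E2 ?E3 ?E4 ?fmap0 ?fmap_id // -fmap_add
      E5 fmap_id.
  + by move=> a b Pb; apply/PE; exact: ideal_tens.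
  + by move=> a b Pa; apply/PE; exact: ideal_tens_r.
- exists 𝟙 => /= P1; apply: (@prime_unit L P).
  apply: (thick_iso PT) P1; apply: isomorphic_sym.
  by exists (funit F); exact: funit_iso (ttfP F).
- by move=> a b /PE/prime_tensE.
Qed.

Definition Spc_map (P : Spc L) : Spc K := MkSpc (preimage_prime P).

Variable Z : set (Spc K).

Lemma supp_above_map (a : K) :
  supp_above Z a -> supp_above (Spc_map @^-1` Z) (F a).
Proof. by move=> Za P /Za. Qed.

Lemma balanced_map (X : K) (f : hom X X) : balanced f -> balanced (fmap F f).
Proof.
rewrite /balanced => bf; have [g [gm _]] := fmul_iso (ttfP F) X X.
rewrite -[LHS]c1m -[RHS]c1m -gm -!cA; congr (g ∘ _).
by rewrite -!fmap_id !(fmul_nat (ttfP F)) bf.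
Qed.

Definition rep_fmap (x : rep Z) : rep (Spc_map @^-1` Z) :=
  Rep (supp_above_map (rep_supp x)) (balanced_map (rep_balanced x)).

End Functoriality.

Definition preimage_restr (S T : Type) (f : S -> T) (Z : set T)
    (x : f @^-1` Z) : Z :=
  exist _ (f (\val x)) (mem_set (set_valP x : Z (f (\val x)))).

(* Main.v *)
(* In Spc and in Spec every ultrafilter F has a limit for the constructible
   topology, the prime of all elements that belong to F-almost every prime. The
   basic open sets (the complements of the supports, resp. the sets D(x)) are
   therefore quasi-compact, and so are finite intersections of quasi-compact
   opens; a limit of an ultrafilter refining the nonempty open subsets of an
   irreducible closed set is its generic point. All this passes to closed
   subspaces, and every map of the diagram pulls basic open sets back to basic
   open sets, hence is spectral. The squares commute because cone(F f) is
   F(cone f). For the universal property of the left square, the supports are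
   closed under finite intersections, so every quasi-compact open subset of the
   preimage of Z is the trace of the complement of a single support. *)

From Pilot Require Import Defs.
From HB Require Import structures.
From mathcomp Require Import all_boot all_order all_algebra.
From mathcomp Require Import all_classical topology.

Set Implicit Arguments.
Unset Strict Implicit.
Unset Printing Implicit Defensive.

Import GRing.Theory.
Local Open Scope classical_set_scope.
Local Open Scope ring_scope.

(** * Ultrafilters and their images *)

Section Ultrafilters.

Lemma ultra_setC (T : Type) (F : set_system T) (A : set T) :
  UltraFilter F -> F (~` A) <-> ~ F A.
Proof.
move=> UF; split=> [FCA FA|]; last by case: (in_ultra_setVsetC A UF).
by have [x []] := filter_ex (filterI FA FCA).
Qed.

Lemma ultra_setU (T : Type) (F : set_system T) (A B : set T) :
  UltraFilter F -> F (A `|` B) -> F A \/ F B.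
Proof.
move=> UF FAB; have [|/(filterI FAB)FA] := in_ultra_setVsetC A UF; first by left.
by right; apply: filterS FA => x [[]].
Qed.

(** Preimages commute with complements, so the image filter still decides every set and is therefore
    maximal. *)
Lemma fmap_ultra (S T : Type) (f : S -> T) (F : set_system S) :
  UltraFilter F -> UltraFilter (nbhs (f @ F)).
Proof.
move=> UF; split; first exact: fmap_proper_filter.
move=> G GG FG; apply/seteqP; split=> // A GA.
have [//|FCA] := in_ultra_setVsetC (f @^-1` A) UF.
by have [x []] := filter_ex (filterI GA (FG (~` A) FCA)).
Qed.

End Ultrafilters.

(* The last clause says that the topology generated by the sets [b i] and their
   complements, the constructible topology, is quasi-compact. *)
Record constructible_basis (T : topologicalType) (I : Type) (b : I -> set T) :
    Prop := ConstructibleBasis {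
  basis_open : forall i, open (b i);
  basis_nbhs : forall (x : T) (U : set T), open U -> U x ->
    exists2 i, b i x & b i `<=` U;
  basis_sep : forall x y : T, (forall i, b i x <-> b i y) -> x = y;
  basis_lim : forall F : set_system T, UltraFilter F ->
    exists x : T, forall i, b i x <-> F (b i)
}.

(** * Spectrality from limits in the constructible topology *)

Section ConstructibleBasis.
Variables (T : topologicalType) (I : Type) (b : I -> set T).
Hypothesis bT : constructible_basis b.

Lemma basis_cvg (F : set_system T) (x : T) : Filter F ->
  (forall i, b i x <-> F (b i)) -> F --> x.
Proof.
move=> FF Fx U; rewrite nbhsE => -[V [oV Vx] VU].
have [i bx bV] := basis_nbhs bT oV Vx.
by apply: filterS (subset_trans bV VU) _; apply/Fx.
Qed.

(** By compactness [F] converges to some [y] in [U]; a basic set around [y] inside [U] belongs to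
    [F], hence contains [x]. *)
Lemma basis_lim_compact_open (F : set_system T) (x : T) (U : set T) :
  UltraFilter F -> (forall i, b i x <-> F (b i)) -> open U -> compact U ->
  F U -> U x.
Proof.
move=> UF Fx oU; rewrite compact_ultra => /(_ F UF) cU /cU[y [Uy Fy]].
have [i by_ bU] := basis_nbhs bT oU Uy; apply/bU/Fx/Fy.
by apply: open_nbhs_nbhs; split=> //; exact: (basis_open bT).
Qed.

Lemma basis_compact i : compact (b i).
Proof.
rewrite compact_ultra => F UF Fb; have [x Fx] := basis_lim bT UF.
by exists x; split; [apply/Fx|exact: basis_cvg].
Qed.

Lemma basis_sober (C : set T) : irreducible_closed C ->
  exists! x : T, closure [set x] = C.
Proof.
move=> [cC [c Cc] irrC].
have clP (A : set T) (y : T) :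
    closure A y <-> forall i, b i y -> A `&` b i !=set0.
  split=> [clA i by_|H U]; first apply: clA.
    by apply: open_nbhs_nbhs; split=> //; exact: (basis_open bT).
  rewrite nbhsE => -[V [oV Vy] VU]; have [i by_ bV] := basis_nbhs bT oV Vy.
  by have [z [Az bz]] := H i by_; exists z; split=> //; exact/VU/bV.
pose F := filter_from [set U : set T | open U /\ C `&` U !=set0]
  (fun U => C `&` U).
have PF : ProperFilter F.
  apply: filter_from_proper => [|U [_ ?] //].
  apply: filter_from_filter.
    by exists setT; split; [exact: openT|exists c].
  move=> U V [oU [u [Cu Uu]]] [oV [v [Cv Vv]]]; exists (U `&` V); last first.
    by move=> x [Cx [Ux Vx]].
  split; first exact: openI.
  (* If [C] missed the intersection, the complements of [U] and [V] would cover it, and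
     irreducibility would place [C] in one of them. *)
  apply: contrapT => UV.
  have [x Cx|CU|CV] := irrC _ _ (open_closedC oU) (open_closedC oV).
  - by apply: contrapT => /not_orP[/contrapT Ux /contrapT Vx]; apply: UV; exists x.
  - exact: CU Cu Uu.
  - exact: CV Cv Vv.
have [G [UG FG]] := ultraFilterLemma PF; have [x Gx] := basis_lim bT UG.
have GC : G C.
  by apply: FG; exists setT => [|y []//]; split; [exact: openT|exists c].
(* The trace on [C] of a basic set meeting [C] belongs to [F], hence to [G]; so [x] lies in all such
   basic sets, which makes it generic. *)
have xE i : b i x <-> C `&` b i !=set0.
  split=> [/Gx Gb|Cb]; first exact: filter_ex (filterI GC Gb).
  apply/Gx/FG; exists (b i) => [|y []//]; split=> //; exact: (basis_open bT).
exists x; split.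
  apply/seteqP; split=> y.
    move=> /clP clx; rewrite (closure_id C).1 //; apply/clP => i /clx[_ [-> bx]].
    exact/xE.
  by move=> Cy; apply/clP => i by_; exists x; split=> //; apply/xE; exists y.
move=> y Ey; apply: (basis_sep bT) => i; rewrite xE; split.
  move=> [z [Cz bz]]; move: Cz; rewrite -Ey => /clP/(_ i bz)[_ [->]] //.
by move=> by_; exists y; split=> //; rewrite -Ey; exact: subset_closure.
Qed.

Lemma constructible_basis_spectral : is_spectral_space T.
Proof.
split.
- rewrite compact_ultra => F UF _; have [x Fx] := basis_lim bT UF.
  by exists x; split=> //; exact: basis_cvg.
- move=> U V oU cU oV cV; rewrite compact_ultra => F UF FUV.
  have [x Fx] := basis_lim bT UF; exists x; split; last exact: basis_cvg.
  by split; apply: (basis_lim_compact_open UF Fx) => //; apply: filterS FUV => y [].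
- move=> x W oW /(basis_nbhs bT oW)[i bx bW].
  by exists (b i); split=> //; [exact: (basis_open bT)|exact: basis_compact].
- exact: basis_sober.
Qed.

(** An ultrafilter on [Z], pushed forward to [T], contains [Z] and converges to its limit, which
    therefore lies in the closed set [Z]. *)
Lemma constructible_basis_closed (Z : set T) : closed Z ->
  constructible_basis (fun i => set_val @^-1` b i : set Z).
Proof.
move=> cZ; have cv : continuous (set_val : Z -> T) by exact: initial_continuous.
split.
- by move=> i; move/continuousP: cv => /(_ _ (basis_open bT i)).
- move=> x _ [V oV <-] Vx; have [i bx bV] := basis_nbhs bT oV Vx.
  by exists i => // y; exact: bV.
- by move=> x y E; apply: val_inj; exact: basis_sep bT _ _ E.
- move=> F UF; have UG := fmap_ultra (set_val : Z -> T) UF.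
  have [x Gx] := basis_lim bT UG.
  have GZ : F (set_val @^-1` Z) by apply: filterE => y; exact: (set_valP y).
  have Zx : Z x.
    rewrite (closure_id Z).1 // => U /(basis_cvg _ Gx) GU.
    exact: filter_ex (filterI GZ GU).
  by exists (exist _ x (mem_set Zx)) => i; exact: Gx.
Qed.

(* With finite unions available, a quasi-compact open set is itself basic. *)
Lemma compact_open_basic (U : set T) :
  (exists i, b i = set0) -> (forall i j, exists k, b k = b i `|` b j) ->
  open U -> compact U -> exists i, U = b i.
Proof.
move=> [i0 b0] bU oU cU; apply: contrapT => nU.
(* If [U] is not basic, these differences are nonempty, and finite unions make them a filter base. A
   basic neighbourhood inside [U] of a cluster point is then disjoint from a member of [F]. *)
pose F := filter_from [set i | b i `<=` U] (fun i => U `\` b i).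
have PF : ProperFilter F.
  apply: filter_from_proper.
    apply: filter_from_filter; first by exists i0; rewrite /= b0.
    move=> i j bi bj; have [k bk] := bU i j; exists k; rewrite /= bk.
      by move=> x [/bi|/bj].
    by move=> x [Ux /not_orP[]].
  move=> i bi; apply: contrapT => E; apply: nU; exists i.
  apply/seteqP; split=> // x Ux; apply: contrapT => bx; apply: E; by exists x.
have [|x [Ux]] := cU F _.
  by exists i0; rewrite /= b0 // => x [].
have [i bx bi] := basis_nbhs bT oU Ux.
move=> /(_ (U `\` b i) (b i))[||y [[]]] //; first by exists i.
by apply: open_nbhs_nbhs; split=> //; exact: (basis_open bT).
Qed.

End ConstructibleBasis.

(** The hypothesis on preimages makes [f] carry the limit of an ultrafilter to the limit of its
    image, and the latter lies in every compact open set belonging to the image. *)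
Lemma basic_spectral_map (S T : topologicalType) (I J : Type)
    (b : I -> set S) (c : J -> set T) (f : S -> T) :
  constructible_basis b -> constructible_basis c ->
  (forall j, exists i, f @^-1` c j = b i) -> is_spectral_map f.
Proof.
move=> bS cT fE; split.
  move=> x U; rewrite nbhsE => -[V [oV Vx] VU].
  have [j cx cV] := basis_nbhs cT oV Vx; have [i fi] := fE j.
  apply: (@filterS _ _ _ (f @^-1` c j)) => [y /cV/VU//|].
  rewrite fi; apply: open_nbhs_nbhs; split; first exact: (basis_open bS).
  by rewrite -fi.
move=> U oU cU; rewrite compact_ultra => F UF FU.
have [x Fx] := basis_lim bS UF; exists x; split; last exact: basis_cvg Fx.
apply: (basis_lim_compact_open cT (fmap_ultra f UF)) => // j.
have [i fi] := fE j; have := Fx i; by rewrite -fi.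
Qed.

(** * The spectrum of a tensor triangulated category *)

Section SpcSpectral.
Variable K : tt_category.

Let Kadd : additive_axioms K :=
  triangulated_additive (tt_triangulated (ttP K)).

Lemma Spc_ext (P Q : Spc K) : spc_set P = spc_set Q -> P = Q.
Proof.
by case: P Q => [P pP] [Q pQ] /= E; subst Q; rewrite (Prop_irrelevance pP pQ).
Qed.

(* Primality is a first-order condition, so it passes to ultraproducts. *)
Lemma ultra_prime (F : set_system (Spc K)) : UltraFilter F ->
  is_prime [set a : K | F [set Q : Spc K | spc_set Q a]].
Proof.
move=> UF; split.
- split; first split.
  + by move=> z zz; apply: filterE => Q; exact: thick_zero (spc_thick Q) _ zz.
  + move=> a b ab; apply: filterS => Q; exact: thick_iso (spc_thick Q) _ _ ab.
  + by move=> a; split; apply: filterS => Q /(thick_susp (spc_thick Q) a).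
  + move=> x y z u v w D; apply: filterS2 => Q.
    exact: thick_dist (spc_thick Q) _ _ _ _ _ _ D.
  + move=> a b c D; apply: filterS => Q.
    exact: thick_summand (spc_thick Q) _ _ _ D.
  + by move=> a b; apply: filterS => Q Qb; apply/prime_tensE; right.
  + by move=> a b; apply: filterS => Q Qa; apply/prime_tensE; left.
- by exists 𝟙 => /filter_ex[Q]; exact: prime_unit.
- move=> a b /= Fab; apply: ultra_setU; apply: filterS Fab => Q.
  by move=> /prime_tensE.
Qed.

Lemma Spc_basis : constructible_basis (fun a : K => ~` supp a).
Proof.
have bE (P : Spc K) (a : K) : (~` supp a) P <-> spc_set P a.
  by split=> [/contrapT|Pa /(_ Pa)].
split.
- move=> a; suff : spc_open (~` supp a) by [].
  by move=> P Pa; exists a; split.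
- by move=> P U oU UP; have [a [Pa aU]] := (oU : spc_open U) P UP; exists a.
- move=> P Q E; apply: Spc_ext; apply/seteqP; split=> a /bE Pa; apply/bE; exact/E.
- move=> F UF; exists (MkSpc (ultra_prime UF)) => a; rewrite bE /=.
  by split; apply: filterS => Q /bE.
Qed.

Lemma Spc_basis0 : exists a : K, ~` supp a = set0.
Proof. by exists 𝟙; apply/seteqP; split=> // P /contrapT; exact: prime_unit. Qed.

(** Primality gives that [supp (a ⊗ b)] is the intersection of the two supports. *)
Lemma Spc_basisU (a b : K) : exists c : K, ~` supp c = ~` supp a `|` ~` supp b.
Proof.
exists (a ⊗ b); rewrite -setCI; congr (~` _); apply/seteqP; split=> P /=.
  by move=> /prime_tensE/not_orP.
by move=> [Pa Pb] /prime_tensE[].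
Qed.

End SpcSpectral.

(** * The spectrum of a commutative ring *)

Section SpecSpectral.
Variable A : comPzRingType.

Lemma Spec_ext (p q : Spec A) : spec_set p = spec_set q -> p = q.
Proof.
by case: p q => [p pp] [q pq] /= E; subst q; rewrite (Prop_irrelevance pp pq).
Qed.

Lemma ultra_prime_ideal (F : set_system (Spec A)) : UltraFilter F ->
  is_prime_ideal [set x : A | F [set q : Spec A | spec_set q x]].
Proof.
move=> UF; split.
- by apply: filterE => q; exact: pideal0 (specP q).
- by move=> x y; apply: filterS2 => q; exact: pidealD (specP q) x y.
- by move=> x y; apply: filterS => q; exact: pidealM (specP q) x y.
- by move=> /filter_ex[q]; exact: pideal1 (specP q).
- move=> x y /= Fxy; apply: ultra_setU; apply: filterS Fxy => q.
  exact: pideal_prime (specP q) x y.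
Qed.

Lemma Spec_basis : constructible_basis (@spec_basic A).
Proof.
split.
- move=> x; suff : spec_open (spec_basic x) by [].
  by move=> p px; exists x; split.
- by move=> p U oU Up; have [x [px xU]] := (oU : spec_open U) p Up; exists x.
- move=> p q E; apply: Spec_ext; apply/seteqP; split=> x px; apply: contrapT.
    by move=> /E.
  by move=> /E; apply.
- move=> F UF; exists (MkSpec (ultra_prime_ideal UF)) => x.
  (* Basic sets are defined here by non-membership, so the negation has to be moved across the
     ultrafilter. *)
  by rewrite -[spec_basic x in X in _ <-> X]setCK ultra_setC /spec_basic setCK.
Qed.

End SpecSpectral.

Lemma Spec_map_spectral (A B : comPzRingType) (h : {rmorphism A -> B}) :
  is_spectral_map (Spec_map h).
Proof.
apply: basic_spectral_map (Spec_basis B) (Spec_basis A) _ => x.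
by exists (h x).
Qed.

(** * Closed subspaces *)

Section ClosedSubspace.
Variables (T : topologicalType) (I : Type) (b : I -> set T) (Z : set T).
Hypothesis bT : constructible_basis b.
Hypothesis cZ : closed Z.

Lemma closed_spectral_space : is_spectral_space Z.
Proof.
exact: constructible_basis_spectral (constructible_basis_closed bT cZ).
Qed.

Lemma closed_spectral_map : is_spectral_map (set_val : Z -> T).
Proof.
apply: basic_spectral_map (constructible_basis_closed bT cZ) bT _ => i.
by exists i.
Qed.

End ClosedSubspace.

(** * Spectrality of the comparison map *)

Section Rho.
Variables (K : tt_category) (Z : set (Spc K)).

Lemma rhoP (P : Z) (x : rep Z) :
  spec_set (rho Z P) (rep_class x) <-> ~ cone_in (set_val P) (rep_map x).
Proof. exact: rho_setP (set_valP P) x. Qed.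

(** The preimage of the basic open set of the class of [f] is the trace on [Z] of the complement of
    the support of a cone of [f]. *)
Lemma rho_spectral : closed Z -> is_spectral_map (rho Z).
Proof.
move=> cZ.
apply: basic_spectral_map (constructible_basis_closed (@Spc_basis K) cZ)
  (Spec_basis _) _ => r.
have [x ->] := rep_class_surj r.
have [c [v [w D]]] := TR1_cone (triangulated_triangles (tt_triangulated (ttP K)))
  (rep_map x).
have Cc : is_cone (rep_map x) c by exists v, w.
exists c; apply/seteqP; split=> P.
  move=> Px; suff Pc : spc_set (set_val P) c by move=> /(_ Pc).
  by apply: (cone_uniq (spc_thick (set_val P)) Cc); apply: contrapT => /rhoP.
by move=> /contrapT Pc /rhoP; apply; exists c.
Qed.

End Rho.

(** * Functoriality in the tensor triangulated category *)

Section Pushforward.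
(* [vector] and [filter] shadow [hom] and [fmap]. *)
Import Pilot.Defs.
Variables (K L : tt_category) (F : tt_functor K L).

Lemma fmap_cone (a b c : K) (f : hom a b) :
  is_cone f c -> is_cone (fmap F f) (F c).
Proof.
by move=> [v [w D]]; exists (fmap F v), (fsusp F a ∘ fmap F w);
  exact: exact_dist (functor_exact (ttfP F)) _ _ _ _ _ _ D.
Qed.

(** An exact functor preserves cones, and whether a cone of a morphism lies in a thick subcategory
    does not depend on the cone chosen. *)
Lemma Spc_map_cone_in (P : Spc L) (a b : K) (f : hom a b) :
  cone_in (Spc_map F P) f <-> cone_in P (fmap F f).
Proof.
split=> [[c Cc Pc]|H]; first by exists (F c) => //; exact: fmap_cone.
have [c [v [w D]]] := TR1_cone (triangulated_triangles (tt_triangulated (ttP K))) f.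
have Cc : is_cone f c by exists v, w.
exists c => //; exact: (cone_uniq (spc_thick P) (fmap_cone Cc) H).
Qed.

Lemma Spc_map_spectral : is_spectral_map (Spc_map F).
Proof.
by apply: basic_spectral_map (@Spc_basis L) (@Spc_basis K) _ => a; exists (F a).
Qed.

Variable Z : set (Spc K).
Let W : set (Spc L) := Spc_map F @^-1` Z.

(** The two underlying objects differ, but [fmul] is an isomorphism between them that intertwines
    the endomorphisms. *)
Lemma class_fmap_tens_l (x : rep Z) a (Za : supp_above Z a) :
  rep_class (rep_fmap F (rep_tens_l Za x)) = rep_class (rep_fmap F x).
Proof.
rewrite -[RHS](class_tens_l (supp_above_map (F := F) Za)); symmetry.
apply: (class_iso (x := rep_tens_l (supp_above_map (F := F) Za) (rep_fmap F x))
  (y := rep_fmap F (rep_tens_l Za x)) (s := fmul F a (rep_ob x))).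
  exact: fmul_iso (ttfP F) _ _.
by rewrite /intertwines /= -(fmap_id F) (fmul_nat (ttfP F)).
Qed.

Lemma class_fmap_tens_r (x : rep Z) a (Za : supp_above Z a) :
  rep_class (rep_fmap F (rep_tens_r x Za)) = rep_class (rep_fmap F x).
Proof.
rewrite -[RHS](class_tens_r (supp_above_map (F := F) Za)); symmetry.
apply: (class_iso (x := rep_tens_r (rep_fmap F x) (supp_above_map (F := F) Za))
  (y := rep_fmap F (rep_tens_r x Za)) (s := fmul F (rep_ob x) a)).
  exact: fmul_iso (ttfP F) _ _.
by rewrite /intertwines /= -(fmap_id F) (fmul_nat (ttfP F)).
Qed.

Lemma class_fmap (x y : rep Z) : rep_class x = rep_class y ->
  rep_class (rep_fmap F x) = rep_class (rep_fmap F y).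
Proof.
move=> /rep_classP; elim=> {x y} //.
- move=> x y [{}x|{}x] a Za; symmetry;
    [exact: class_fmap_tens_l|exact: class_fmap_tens_r].
- by move=> x y z _ -> _ ->.
Qed.

Definition endo_ring_map (r : endo_ring Z) : endo_ring W :=
  rep_class (rep_fmap F (repr r)).

Lemma endo_ring_mapE (x : rep Z) :
  endo_ring_map (rep_class x) = rep_class (rep_fmap F x).
Proof. by apply: class_fmap; rewrite repr_class. Qed.

Lemma endo_ring_mapD : {morph endo_ring_map : r s / r + s}.
Proof.
(* On a common object the ring operations are those of endomorphisms, which [F] preserves; 0 only
   fills the third slot of [common_rep]. *)
move=> r s; have [X [ZX [f [g [_ [bf [bg [_ [-> -> _]]]]]]]]] := common_rep r s 0.
rewrite [_ + _](er_add_same ZX bf bg) !endo_ring_mapE.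
rewrite [RHS](er_add_same (supp_above_map (F := F) ZX)
  (balanced_map F bf) (balanced_map F bg)).
by congr rep_class; apply: Rep_ext; rewrite /= fmap_add.
Qed.

Lemma endo_ring_mapM : {morph endo_ring_map : r s / r * s}.
Proof.
move=> r s; have [X [ZX [f [g [_ [bf [bg [_ [-> -> _]]]]]]]]] := common_rep r s 0.
rewrite [_ * _](er_mul_same ZX bf bg) !endo_ring_mapE.
rewrite [RHS](er_mul_same (supp_above_map (F := F) ZX)
  (balanced_map F bf) (balanced_map F bg)).
by congr rep_class; apply: Rep_ext; rewrite /= fmap_comp.
Qed.

Lemma endo_ring_map1 : endo_ring_map 1 = 1.
Proof.
rewrite [1 in LHS]/(er_one Z) endo_ring_mapE.
rewrite [RHS](er_one_same (supp_above_map (F := F) (@supp_above_unit K Z))).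
by congr rep_class; apply: Rep_ext; rewrite /= fmap_id.
Qed.

Lemma endo_ring_mapB : {morph endo_ring_map : r s / r - s}.
Proof.
move=> r s; apply: (addIr (endo_ring_map s)).
by rewrite -endo_ring_mapD !subrK.
Qed.

HB.instance Definition _ := GRing.isZmodMorphism.Build (endo_ring Z) (endo_ring W)
  endo_ring_map endo_ring_mapB.
HB.instance Definition _ := GRing.isMonoidMorphism.Build (endo_ring Z)
  (endo_ring W) endo_ring_map (conj endo_ring_map1 endo_ring_mapM).

(** On the class of [f] both primes test whether the cone of [F f], that is [F] of the cone of [f],
    avoids [P]. *)
Lemma rho_natural (P : W) :
  Spec_map (endo_ring_map : {rmorphism _ -> _}) (rho W P) =
  rho Z (@preimage_restr _ _ (Spc_map F) Z P).
Proof.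
apply: Spec_ext; apply/funext => r; apply/propext.
have [x ->] := rep_class_surj r.
have /propext -> : spec_set (Spec_map (endo_ring_map : {rmorphism _ -> _}) (rho W P))
    (rep_class x) <-> spec_set (rho W P) (rep_class (rep_fmap F x)).
  by rewrite -endo_ring_mapE.
by rewrite !rhoP (Spc_map_cone_in (set_val P) (rep_map x)).
Qed.

Hypothesis cZ : closed Z.

Lemma closed_Spc_preimage : closed W.
Proof.
have /continuous_closedP := Spc_map_spectral.1; exact.
Qed.

Lemma Spc_restr_spectral :
  is_spectral_map (@preimage_restr _ _ (Spc_map F) Z : W -> Z).
Proof.
apply: basic_spectral_map
  (constructible_basis_closed (@Spc_basis L) closed_Spc_preimage)
  (constructible_basis_closed (@Spc_basis K) cZ) _ => a.
by exists (F a).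
Qed.

Lemma Spc_pullback : is_spectral_pullback (set_val : W -> Spc L)
  (@preimage_restr _ _ (Spc_map F) Z) (Spc_map F) (set_val : Z -> Spc K).
Proof.
have bW := constructible_basis_closed (@Spc_basis L) closed_Spc_preimage.
split=> // T u v sT [cu su] _ E.
have Wu t : W (u t).
  by have /= := E t; rewrite /W /= => ->; exact: set_valP.
pose w t : W := exist _ (u t) (mem_set (Wu t)).
exists w; split.
  split=> //; last by move=> t; apply: val_inj; exact: E.
  split.
    apply/continuousP => _ [V oV <-].
    by move/continuousP: cu => /(_ _ oV).
  move=> U oU cU.
  (* [U] is the trace on [W] of a compact open subset of [Spc L], so its preimage under [w] is a
     preimage under the spectral map [u]. *)
  have [||a ->] := compact_open_basic bW _ _ oU cU.
  - have [a a0] := Spc_basis0 L; exists a; by rewrite a0 preimage_set0.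
  - move=> a a'; have [c cE] := Spc_basisU a a'; exists c.
    by rewrite cE preimage_setU.
  apply: (su (~` supp a)); first exact: basis_open (@Spc_basis L) a.
  exact: basis_compact (@Spc_basis L) a.
move=> w' [_ uw' _]; apply/funext => t; apply: val_inj; exact/esym/uw'.
Qed.

End Pushforward.

(** * Assembly of the diagram *)

Theorem proposition4p24 (K L : tt_category) (F : tt_functor K L)
    (Z : set (Spc K)) (Zclosed : closed Z) :
  let phi : Spc L -> Spc K := Spc_map F in
  let W : set (Spc L) := phi @^-1` Z in
  let phiZ : W -> Z := @preimage_restr (Spc L) (Spc K) phi Z in
  exists h : {rmorphism endo_ring Z -> endo_ring W},
    [/\ forall x : rep Z, h (rep_class x) = rep_class (rep_fmap F x),
        [/\ is_spectral_space (Spc L), is_spectral_space W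
          & is_spectral_space (Spec (endo_ring W))] /\
        [/\ is_spectral_space (Spc K), is_spectral_space Z
          & is_spectral_space (Spec (endo_ring Z))],
        [/\ is_spectral_map phi, is_spectral_map phiZ,
            is_spectral_map (Spec_map h)
          & [/\ is_spectral_map (set_val : W -> Spc L),
                is_spectral_map (set_val : Z -> Spc K),
                is_spectral_map (rho W) & is_spectral_map (rho Z)]],
        forall P : W, Spec_map h (rho W P) = rho Z (phiZ P)
      &        is_spectral_pullback (set_val : W -> Spc L) phiZ
          phi (set_val : Z -> Spc K)].
Proof.
move=> phi W phiZ.
have cW : closed W by exact: closed_Spc_preimage.
have Spcs (M : tt_category) : is_spectral_space (Spc M).
  exact: constructible_basis_spectral (@Spc_basis M).
have Specs (A : comPzRingType) : is_spectral_space (Spec A).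
  exact: constructible_basis_spectral (Spec_basis A).
exists (@endo_ring_map K L F Z); split.
- exact: endo_ring_mapE.
- by do 2!split=> //; apply: closed_spectral_space (@Spc_basis _) _.
- split; [exact: Spc_map_spectral|exact: Spc_restr_spectral|exact: Spec_map_spectral|].
  by split; do ?[exact: rho_spectral | exact: closed_spectral_map (@Spc_basis _) _].
- exact: rho_natural.
- exact: Spc_pullback.
Qed.
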